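(* Let $c,h\in\mathbb{C}$ and let $U=U(c,h,k)=\mathbb{C}[x]/((x-h)^k)$ for $k\ge1$. If $T(c,h)=0$, then the $V_{Vir}(c,0)$-modules $W=W(c,h,k)=\mathfrak L_0(U(c,h,k))=M_0(U(c,h,k))$ are strongly interlocked, and $\mathrm{pstr}_W(v,\tau)$ is well defined for every $v\in V_{Vir}(c,0)$. In particular, letting $\{u_1,\dots,u_k\}$ be a Jordan basis for $o(\omega)=L_0$ acting on $U(c,h,k)$, and setting $W^{(j)}=\mathfrak L_0(\mathrm{span}\{u_1,\dots,u_j\})$ for $j=0,\dots,k$, the submodule $W^{(j)}$ is interlocked with $W^{(k-j)}$, and $\langle u_1\rangle=Soc(W(c,h,k))$ is interlocked with $\langle u_1,\dots,u_{k-1}\rangle=Rad(W(c,h,k))$. Furthermore, for $v\in V_{Vir}(c,0)$, $o(v)$ acting on $W(c,h,k)(\ell)$ has a $k\mathfrak p(\ell)\times k\mathfrak p(\ell)$ matrix realization as a $k\times k$ block upper triangular matrix with blocks of size $\mathfrak p(\ell)\times\mathfrak p(\ell)$, all diagonal blocks equal to $A=o(v)|_{Soc(W(c,h,k))(\ell)}$, first block row $(A,C_1,\dots,C_{k-2},B)$ and last block column $(B,C_{k-2},\dots,C_1,A)^T$, since $\dim Soc(W)(\ell)=\mathfrak p(\ell)$, where $\mathfrak p(\ell)$ is the number of partitions of $\ell$.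
   Context: $\mathcal L$ is the Virasoro algebra, basis $L_n$ ($n\in\mathbb{Z}$), $\mathbf c$ central, $[L_m,L_n]=(m-n)L_{m+n}+\frac{m^3-m}{12}\delta_{m+n,0}\mathbf c$. $M(c,h)$ is the Verma module generated by $\mathbf 1_{c,h}$ ($L_0=h$, $\mathbf c=c$, $L_n\mathbf 1_{c,h}=0$ for $n>0$), $T(c,h)$ its maximal proper submodule. $V_{Vir}(c,0)=M(c,0)/\langle L_{-1}\mathbf 1_{c,0}\rangle$ is the universal Virasoro vertex operator algebra, conformal vector $\omega=L_{-2}\mathbf 1_{c,0}$, with level zero Zhu algebra $\mathbb{C}[x]$, $x$ the class of $\omega$ (acting on degree-zero spaces as $L_0$). The Jordan basis satisfies $L_0u_1=hu_1$, $L_0u_j=hu_j+u_{j-1}$. $M_0(U)$ is the universal $V_{Vir}(c,0)$-module with degree zero space $U$: the $\mathcal L$-module induced from $U$ with $L_n=0$ ($n>0$), $L_0=x$, $\mathbf c=c$ on $U$, graded with $L_{-n_1}\cdots L_{-n_m}u$ in degree $\sum n_i$; $\mathfrak L_0(U)$ is its quotient by the submodule of all $v$ with $yv$ having zero degree-zero component for all $y\in\mathcal U(\mathcal L)$. $W(\ell)=W_{h+\ell}$ is the degree $\ell$ subspace, the generalized $L_0$-eigenspace of weight $h+\ell$. For a vertex operator algebra $V$ of central charge $c$ and homogeneous $v\in V$, $o(v)=v_{\mathrm{wt}\,v-1}$. Submodules $W^{(1)},W^{(2)}$ of a generalized module $W$ (direct sum of finite-dimensional generalized $L_0$-eigenspaces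 $W_\mu$, weights in each coset of $\mathbb Z$ bounded below) are interlocked with each other if $W^{(1)}\cong W/W^{(2)}$ and $W^{(2)}\cong W/W^{(1)}$. An indecomposable $W$ is interlocked if every submodule is interlocked with some submodule; an interlocked $W$ is strongly interlocked if it is irreducible, or it is reducible and has only finitely many nontrivial proper submodules $W^{(1)},\dots,W^{(k-1)}$, each indecomposable, with $0=W^{(0)}\subset W^{(1)}\subset\cdots\subset W^{(k)}=W$ and $W^{(j+1)}/W^{(j)}\cong W^{(1)}$ for all $j$. $Soc$ is the sum of simple submodules, $Rad$ the intersection of maximal proper submodules. A weight-preserving module operator is a linear operator preserving all $W_\mu$ and lying in the algebra generated by the modes $v_n$ ($v\in V$) and the $V$-module endomorphisms. A strongly interlocked family of bases is a choice of ordered basis of every $W_\mu$ in which every such operator $\sigma$ has a matrix of the block form described in the claim (with $A=\sigma|_{Soc(W)_\mu}$, blocks of size $\dim Soc(W)_\mu$). If $\mathrm{tr}(B)$ is independent of the choice of such a family then $\mathrm{pstr}(\sigma|_{W_\mu})=\mathrm{tr}(B)$, graded pseudo-traces are well defined, and $\mathrm{pstr}_W(v,\tau)=\sum_\mu\sum_{j\ge0}\mathrm{pstr}(o(v)|_{W_\mu}\frac1{j!}(L_0^N)_\mu^j)(\log q)^jq^{\mu-c/24}$, $q=e^{2\pi i\tau}$, $\log q=2\pi i\tau$, $L_0^N$ the nilpotent part of $L_0$ (set to $0$ if $W$ is irreducible).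
   Formalization: Independence of tr(B) is proved only among strongly interlocked families normalized by the Jordan form of L_0 (blockwise L_0 b_1 = μ b_1, L_0 b_j = μ b_j + b_{j-1}); over all strongly interlocked families it fails for k ≥ 2, as rescaling u_2 shows. *)

(* Defs.v *)
From HB Require Import structures.
From mathcomp Require Import all_boot all_order all_algebra.
From mathcomp Require Import complex.
From mathcomp Require Import boolp classical_sets reals.

Set Implicit Arguments.
Unset Strict Implicit.
Unset Printing Implicit Defensive.

Import GRing.Theory.
Local Open Scope classical_set_scope.
Local Open Scope ring_scope.

(** * Linear algebra in spaces of arbitrary dimension *)

Section LinearAlgebra.
Context {C : fieldType} {W : lmodType C}.

Definition subspace (S : set W) : Prop :=
  S 0 /\ forall (a : C) (u v : W), S u -> S v -> S (a *: u + v).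

Definition lspan (A : set W) : set W :=
  [set w | exists s : seq (C * W),
     (forall p, p \in s -> A p.2) /\ w = \sum_(p <- s) p.1 *: p.2].

Definition is_basis (S : set W) (J : finType) (b : J -> W) : Prop :=
  (forall w, S w <-> exists a : J -> C, w = \sum_j a j *: b j) /\
  (forall a : J -> C, \sum_j a j *: b j = 0 -> forall j, a j = 0).

Definition has_dim (S : set W) (n : nat) : Prop :=
  exists b : 'I_n -> W, is_basis S b.

(* The unital algebra of operators on [W] generated by [S]. *)
Inductive generated_algebra (S : set (W -> W)) : (W -> W) -> Prop :=
| GenAlgBase f : S f -> generated_algebra S f
| GenAlgOne : generated_algebra S id
| GenAlgLin a f g : generated_algebra S f -> generated_algebra S g ->
    generated_algebra S (fun w => a *: f w + g w)
| GenAlgMul f g : generated_algebra S f -> generated_algebra S g ->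
    generated_algebra S (f \o g).

End LinearAlgebra.

(** * Modules as spaces with a family of operators

    A module (over the Virasoro algebra, or over a vertex operator algebra) is
    given by its family of acting operators [op : I -> W -> W]. *)

Section OperatorModules.
Context {C : fieldType} {I : Type} {W : lmodType C} (op : I -> W -> W).

Definition submodule (S : set W) : Prop :=
  subspace S /\ forall i w, S w -> S (op i w).

Definition submodule_generated (A : set W) : set W :=
  [set w | forall S, submodule S -> A `<=` S -> S w].

Definition simple_submodule (S : set W) : Prop :=
  [/\ submodule S, S <> [set 0] &
      forall S', submodule S' -> S' `<=` S -> S' = [set 0] \/ S' = S].

Definition irreducible_module : Prop := simple_submodule setT.

Definition maximal_proper_submodule (S : set W) : Prop :=
  [/\ submodule S, S <> setT &
      forall S', submodule S' -> S `<=` S' -> S' = S \/ S' = setT].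

Definition socle : set W :=
  lspan [set w | exists2 S, simple_submodule S & S w].

Definition radical : set W :=
  [set w | forall S, maximal_proper_submodule S -> S w].

Definition indecomposable (S : set W) : Prop :=
  S <> [set 0] /\
  forall A B, submodule A -> submodule B ->
    A `&` B = [set 0] -> S = [set a + b | a in A & b in B] ->
    A = [set 0] \/ B = [set 0].

Definition module_endomorphism (f : W -> W) : Prop :=
  linear f /\ forall i w, f (op i w) = op i (f w).

End OperatorModules.

(* [A / B] and [A' / B'] are isomorphic modules, for submodules [B `<=` A] and
   [B' `<=` A']: [f] sends representatives to representatives, and the map
   induced on classes is well defined, linear, equivariant, injective and
   surjective. *)
Definition subquotient_iso (C : fieldType) (I : Type) (W W' : lmodType C)
    (op : I -> W -> W) (op' : I -> W' -> W')
    (A B : set W) (A' B' : set W') : Prop :=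
  exists f : W -> W',
    [/\ forall w, A w -> A' (f w),
        forall (a : C) u v, A u -> A v -> B' (f (a *: u + v) - (a *: f u + f v)),
        forall i w, A w -> B' (f (op i w) - op' i (f w)),
        forall w, A w -> (B' (f w) <-> B w) &
        forall w', A' w' -> exists2 w, A w & B' (f w - w')].

(** * The Virasoro algebra, induced modules *)

Section Virasoro.
Context {C : fieldType}.

(* A module for the Virasoro algebra on which the central element acts as the
   scalar [c], given by the action of the [L_n]. *)
Definition virasoro_module (c : C) (M : lmodType C) (L : int -> M -> M) : Prop :=
  (forall n, linear (L n)) /\
  forall m n w,
    L m (L n w) - L n (L m w) =
      (m - n)%:~R *: L (m + n) w
      + (if m + n == 0 then (m ^+ 3 - m)%:~R / 12%:R * c else 0) *: w.

(* [g] is a homomorphism from [U], on which [L_n] acts by [0] for [n > 0] and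
   [L_0] acts by [x]. *)
Definition degree_zero_map (U : lmodType C) (x : U -> U)
    (N : lmodType C) (L : int -> N -> N) (g : U -> N) : Prop :=
  [/\ linear g, forall (n : int) u, 0 < n -> L n (g u) = 0 &
      forall u, L 0 (g u) = g (x u)].

(* [M], with [i : U -> M], is the module of central charge [c] induced from
   [U]; induction is expressed by its universal property. *)
Definition induced_module (c : C) (U : lmodType C) (x : U -> U)
    (M : lmodType C) (L : int -> M -> M) (i : U -> M) : Prop :=
  [/\ virasoro_module c L, degree_zero_map x L i &
      forall (N : lmodType C) (L' : int -> N -> N) (g : U -> N),
        virasoro_module c L' -> degree_zero_map x L' g ->
        exists! f : M -> N,
          [/\ linear f, forall n w, f (L n w) = L' n (f w) &
              forall u, f (i u) = g u]].

Definition verma_module (c h : C) (M : lmodType C) (L : int -> M -> M) (v0 : M) :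
    Prop :=
  induced_module c (fun a : C^o => (h * a : C^o)) L (fun a : C^o => (a : C) *: v0).

Section Induced.
Context {U M : lmodType C} (L : int -> M -> M) (i : U -> M).

Definition degree_space (l : nat) : set M :=
  lspan [set w | exists (s : seq nat) (u : U),
    [/\ all (leq 1) s, sumn s = l &
        w = foldr (fun n v => L (- n%:Z) v) (i u) s]].

(* The submodule of [M_0(U)] by which one quotients to get the module
   L_0(U): all [y w], for [y] in the enveloping algebra, lie in the sum of the
   components of positive degree. *)
Definition frakL0_kernel : set M :=
  [set w | forall y, generated_algebra (range L) y ->
     lspan (\bigcup_(l in [set l | (0 < l)%N]) degree_space l) (y w)].

End Induced.
End Virasoro.

(** * Vertex operator algebras and their modules *)

Definition int_binomial (C : fieldType) (p : int) (i : nat) : C :=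
  (\prod_(j < i) (p - j%:Z)%:~R) / i`!%:R.

(* The Jacobi identity in component form (Borcherds' identity). All three sums
   are finite by truncation, hence are written as partial sums up to any
   sufficiently large bound. *)
Definition borcherds_identity (C : fieldType) (V W : lmodType C)
    (Y : V -> int -> V -> V) (YW : V -> int -> W -> W) : Prop :=
  forall (u v : V) (p q r : int) (w : W), exists N : nat, forall n, (N <= n)%N ->
    \sum_(i < n) int_binomial C p i *: YW (Y u (r + i%:Z) v) (p + q - i%:Z) w =
    \sum_(i < n) ((-1) ^+ i * int_binomial C r i) *:
       (YW u (p + r - i%:Z) (YW v (q + i%:Z) w)
        - ((-1) ^ r) *: YW v (q + r - i%:Z) (YW u (p + i%:Z) w)).

(* [Y v n] is the mode [v_n]. The grading is the one by [L_0]-eigenvalues: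
   [V_n] is the eigenspace of [L_0 = omega_1] for the eigenvalue [n : int]. *)
Record voa_axioms (C : fieldType) (V : lmodType C) (Y : V -> int -> V -> V)
    (vac omega : V) (c : C) (L := fun n : int => Y omega (n + 1)) : Prop :=
  VoaAxioms {
  voa_linear_l : forall n w, linear (fun v => Y v n w);
  voa_linear_r : forall v n, linear (Y v n);
  voa_truncation : forall v w, exists N : int, forall n, N <= n -> Y v n w = 0;
  voa_vacuum : forall n w, Y vac n w = if n == -1 then w else 0;
  voa_creation : forall v, Y v (-1) vac = v /\
    (forall n : int, 0 <= n -> Y v n vac = 0);
  voa_jacobi : borcherds_identity Y Y;
  voa_virasoro : virasoro_module c L;
  voa_derivative : forall v n w, Y (L (-1) v) n w = - n%:~R *: Y v (n - 1) w;
  voa_grading : forall v, exists s : seq (int * V),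
    (forall p, p \in s -> L 0 p.2 = p.1%:~R *: p.2) /\ v = \sum_(p <- s) p.2;
  voa_finite : forall n : int, exists d,
    has_dim [set v | L 0 v = n%:~R *: v] d;
  voa_bounded : exists N : int, forall n : int, n < N ->
    [set v | L 0 v = n%:~R *: v] = [set 0];
  voa_vacuum_weight : L 0 vac = 0;
  voa_conformal_weight : L 0 omega = 2%:R *: omega }.

Record voa (C : fieldType) := Voa {
  voa_carrier :> lmodType C;
  voaY : voa_carrier -> int -> voa_carrier -> voa_carrier;
  voa_vac : voa_carrier;
  voa_omega : voa_carrier;
  voa_charge : C;
  voa_ax : voa_axioms voaY voa_vac voa_omega voa_charge }.

Definition voaL (C : fieldType) (V : voa C) (n : int) (v : V) : V :=
  voaY (voa_omega V) (n + 1) v.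

(* A weak module; the grading conditions are in [generalized_module]. *)
Record vmodule (C : fieldType) (V : voa C) := Vmodule {
  vmod_carrier :> lmodType C;
  vmodY : V -> int -> vmod_carrier -> vmod_carrier;
  vmod_linear_l : forall n w, linear (fun v => vmodY v n w);
  vmod_linear_r : forall v n, linear (vmodY v n);
  vmod_truncation : forall v w,
    exists N : int, forall n, N <= n -> vmodY v n w = 0;
  vmod_vacuum : forall n w, vmodY (voa_vac V) n w = if n == -1 then w else 0;
  vmod_jacobi : borcherds_identity (@voaY C V) vmodY;
  vmod_derivative : forall v n w,
    vmodY (voaL (-1) v) n w = - n%:~R *: vmodY v (n - 1) w }.

(* [V] is V_Vir(c,0): the quotient of the Verma module M(c,0) by the submodule
   generated by [L_{-1} 1], with conformal vector [L_{-2} 1]. *)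
Definition is_universal_virasoro_voa (C : fieldType) (c : C) (V : voa C) : Prop :=
  [/\ voa_charge V = c,
      voa_omega V = voaL (-2) (voa_vac V) &
      exists (M : lmodType C) (L : int -> M -> M) (v0 : M) (f : M -> V),
        [/\ verma_module c 0 L v0,
            linear f /\ (forall n w, f (L n w) = voaL n (f w)),
            f v0 = voa_vac V,
            range f = setT &
            [set w | f w = 0] = submodule_generated L [set L (-1) v0]]].

Section VModules.
Context {C : fieldType} {V : voa C} (W : vmodule V).

Definition modes (p : V * int) : W -> W := vmodY p.1 p.2.
Arguments modes : clear implicits.

Definition vmodL (n : int) : W -> W := vmodY (voa_omega V) (n + 1).
Arguments vmodL : clear implicits.

(* o(v), extended linearly to non-homogeneous [v]: the chosen decomposition of
   [v] into homogeneous vectors does not matter. *)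
Definition zero_mode (v : V) (w : W) : W :=
  \sum_(p <- projT1 (cid (voa_grading (voa_ax V) v))) vmodY p.2 (p.1 - 1) w.

Definition weight_space (mu : C) : set W :=
  [set w | exists n, iter n (fun u => vmodL 0 u - mu *: u) w = 0].
Arguments weight_space : clear implicits.

(* Generalized eigenspaces are always independent, so it is enough to require
   that they span. *)
Definition generalized_module : Prop :=
  [/\ lspan (\bigcup_mu weight_space mu) = setT,
      forall mu, exists d, has_dim (weight_space mu) d &
      forall mu, exists N : int, forall n : int, n < N ->
        weight_space (mu + n%:~R) = [set 0]].

Definition interlocked (W1 W2 : set W) : Prop :=
  subquotient_iso modes modes W1 [set 0] setT W2 /\
  subquotient_iso modes modes W2 [set 0] setT W1.

Definition interlocked_module : Prop :=
  [/\ generalized_module, indecomposable modes setT &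
      forall S, submodule modes S ->
        exists2 S', submodule modes S' & interlocked S S'].

Definition interlocked_chain (k : nat) (F : nat -> set W) : Prop :=
  [/\ F 0%N = [set 0] /\ F k = setT,
      forall j, (j < k)%N -> F j `<` F j.+1,
      forall j, (0 < j < k)%N -> submodule modes (F j) /\ indecomposable modes (F j),
      forall S, submodule modes S -> S <> [set 0] -> S <> setT ->
        exists2 j, (0 < j < k)%N & S = F j &
      forall j, (j < k)%N ->
        subquotient_iso modes modes (F j.+1) (F j) (F 1%N) [set 0]].

(* [k - 1] is the number of nontrivial proper submodules. *)
Definition strongly_interlocked_length (k : nat) : Prop :=
  interlocked_module /\
  ((k = 1%N /\ irreducible_module modes) \/
   ((1 < k)%N /\ ~ irreducible_module modes /\ exists F, interlocked_chain k F)).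

Definition strongly_interlocked : Prop := exists k, strongly_interlocked_length k.

Definition weight_preserving_operator (sigma : W -> W) : Prop :=
  [/\ linear sigma,
      forall mu w, weight_space mu w -> weight_space mu (sigma w) &
      generated_algebra (range modes `|` [set f | module_endomorphism modes f])
        sigma].

(** ** Block matrices and pseudo-traces

    A basis of a weight space in [k] blocks of size [d] is
    [b : nat -> 'I_d -> W], ordered lexicographically, where only the blocks
    [b 0], ..., [b k.-1] matter; a k x k block matrix is
    [X : nat -> nat -> 'M_d]. *)

Definition block_basis (k : nat) (S : set W) (d : nat) (b : nat -> 'I_d -> W) :
    Prop :=
  is_basis S (fun p : 'I_k * 'I_d => b p.1 p.2).

Definition block_matrix_of (k d : nat) (b : nat -> 'I_d -> W) (sigma : W -> W)
    (X : nat -> nat -> 'M[C]_d) : Prop :=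
  forall j s, (j < k)%N ->
    sigma (b j s) = \sum_(i < k) \sum_(r < d) X i j r s *: b i r.

(* For [k = 1] this gives [B = A]: the pseudo-trace of an irreducible module is
   the trace. *)
Definition block_form (k d : nat) (X : nat -> nat -> 'M[C]_d)
    (A : 'M[C]_d) (D : nat -> 'M[C]_d) (B : 'M[C]_d) : Prop :=
  [/\ forall i j, (j < i < k)%N -> X i j = 0,
      forall i, (i < k)%N -> X i i = A,
      forall j, (0 < j < k.-1)%N -> X 0%N j = D j,
      X 0%N k.-1 = B &
      forall j, (0 < j < k.-1)%N -> X (k.-1 - j)%N k.-1 = D j].

Record basis_family := BasisFamily {
  fam_dim : C -> nat;
  fam_vec : forall mu : C, nat -> 'I_(fam_dim mu) -> W }.
Arguments fam_vec : clear implicits.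

(* That the first block is a basis of [Soc(W)_mu] expresses both that the
   blocks have size [\dim Soc(W)_mu] and that the diagonal block is the matrix
   of the restriction of the operator to [Soc(W)_mu]. *)
Definition strongly_interlocked_family (k : nat) (b : basis_family) : Prop :=
  forall mu,
    [/\ block_basis k (weight_space mu) (fam_vec b mu),
        is_basis (socle modes `&` weight_space mu) (fam_vec b mu 0%N) &
        forall sigma, weight_preserving_operator sigma ->
          exists X A D B,
            block_matrix_of k (fam_vec b mu) sigma X /\ block_form k X A D B].

(* Normalization of a family by the Jordan form of [L_0]. The block form is
   preserved when, e.g., the block [b j] is multiplied by [t ^+ j] for all [j],
   whereas [\tr B] is then multiplied by [t ^+ k.-1]: only for families that
   are compatible with the Jordan form is [\tr B] independent of choices. *)
Definition L0_jordan_family (k : nat) (b : basis_family) : Prop :=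
  forall mu s,
    vmodL 0 (fam_vec b mu 0%N s) = mu *: fam_vec b mu 0%N s /\
    forall j, (j.+1 < k)%N ->
      vmodL 0 (fam_vec b mu j.+1 s) =
        mu *: fam_vec b mu j.+1 s + fam_vec b mu j s.

Definition pstr_family (k : nat) (b : basis_family) : Prop :=
  strongly_interlocked_family k b /\ L0_jordan_family k b.

Definition tr_B (k : nat) (b : basis_family) (sigma : W -> W) (mu t : C) : Prop :=
  exists X A D B,
    [/\ block_matrix_of k (fam_vec b mu) sigma X, block_form k X A D B &
        t = \tr B].

Definition pstr_well_defined (k : nat) : Prop :=
  (exists b, pstr_family k b) /\
  forall sigma mu, weight_preserving_operator sigma ->
    exists t, forall b, pstr_family k b ->
      forall t', tr_B k b sigma mu t' <-> t' = t.

Definition is_pstr (k : nat) (sigma : W -> W) (mu t : C) : Prop :=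
  weight_preserving_operator sigma /\
  forall b, pstr_family k b -> tr_B k b sigma mu t.

Definition L0_nilpotent_part (N : W -> W) : Prop :=
  [/\ linear N,
      forall mu w, weight_space mu w -> N w = vmodL 0 w - mu *: w &
      irreducible_module modes -> forall w, N w = 0].

(* The graded pseudo-trace is a formal series, no convergence being involved:
   [a e j] is the coefficient of [(log q)^j q^e] in the formal series
   pstr_W(v,tau). *)
Definition graded_pstr (k : nat) (v : V) (a : C -> nat -> C) : Prop :=
  exists2 N, L0_nilpotent_part N &
    forall mu j,
      is_pstr k (fun w => zero_mode v ((j`!%:R)^-1 *: iter j N w)) mu
        (a (mu - voa_charge V / 24%:R) j).

End VModules.

Arguments modes {C V} W p _.
Arguments vmodL {C V} W n _.
Arguments weight_space {C V} W mu _.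
Arguments fam_vec {C V W} b mu _ _.

(** * The modules attached to [C[x]/((x-h)^k)] *)

Section Jordan.
Context {C : fieldType}.

Definition Uchk (h : C) (k : nat) := {poly %/ ('X - h%:P) ^+ k}.

Definition Ux (h : C) (k : nat) (u : Uchk h k) : Uchk h k := 'qX * u.
Arguments Ux : clear implicits.

Definition span_upto (h : C) (k : nat) (u : nat -> Uchk h k) (j : nat) :
    {vspace Uchk h k} :=
  <<[seq u i | i <- iota 1 j]>>%VS.

(* The basis is [u 1], ..., [u k]. *)
Definition jordan_basis (h : C) (k : nat) (u : nat -> Uchk h k) : Prop :=
  [/\ basis_of fullv [seq u i | i <- iota 1 k],
      Ux _ _ (u 1%N) = h *: u 1%N &
      forall j, (1 < j <= k)%N -> Ux _ _ (u j) = h *: u j + u j.-1].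

(* For a subspace [S] of [U] stable under [x]: the canonical map
   M_0(S) -> M = M_0(U) induces an isomorphism of L_0(S) onto the subset [X]
   of [M]. *)
Definition is_frakL0_of_subspace (c : C) (U : vectType C) (x : U -> U)
    (M : lmodType C) (L : int -> M -> M) (i : U -> M) (S : {vspace U})
    (X : set M) : Prop :=
  (forall u, u \in S -> x u \in S) /\
  exists (M' : lmodType C) (L' : int -> M' -> M') (i' : subvs_of S -> M')
         (f : M' -> M),
    [/\ induced_module c (fun s : subvs_of S => vsproj S (x (vsval s))) L' i',
        linear f /\ (forall n w, f (L' n w) = L n (f w)),
        forall s, f (i' s) = i (vsval s),
        [set w | f w = 0] = frakL0_kernel L' i' &
        range f = X].

End Jordan.

Arguments Ux {C} h k u.

(* The number of partitions of [l], a partition being given by the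
   multiplicities [m i] of the parts [i.+1]. *)
Definition partitions (l : nat) : nat :=
  #|[pred m : {ffun 'I_l -> 'I_l.+1} | (\sum_(i < l) i.+1 * m i == l)%N]|.

(* Main.v *)
Require Import Defs.
From HB Require Import structures.
From mathcomp Require Import all_boot all_order all_algebra.
From mathcomp Require Import complex.
From mathcomp Require Import boolp classical_sets reals.
From mathcomp Require Import freeg zify ring.

Set Implicit Arguments.
Unset Strict Implicit.
Unset Printing Implicit Defensive.

Import Order.TTheory GRing.Theory Num.Theory.
Local Open Scope classical_set_scope.
Local Open Scope ring_scope.

(** By the Poincare-Birkhoff-Witt theorem, W = M_0(U) is free over
    C[x]/((x-h)^k) on the partition monomials, so multiplication by x - h
    extends to a nilpotent endomorphism theta of W, which is the nilpotent part
    of L_0. The kernels of the powers of theta are also their images, and the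
    first one is the Verma module M(c,h), which is simple as T(c,h) = 0.
    Projecting a submodule to degree zero by polynomials in L_0 shows that the
    kernels of the powers of theta are the only submodules; powers of theta
    then induce all the isomorphisms required for interlocking.

    As V is generated by omega, modes, endomorphisms, and hence all
    weight-preserving operators, commute with theta. In a basis of W_mu whose
    blocks are shifted by theta their matrices are therefore block Toeplitz,
    i.e. matrices over C[t]/(t^k), and tr(B) is the coefficient of t^(k-1) of
    the trace over this ring, which is invariant under change of basis. *)

(** The induced module is known only through its universal property, so freeness, and with it every
    statement on dimensions and kernels, has to come from an explicit model. Once that model is
    available, any induced module carries [U]-valued coordinates indexed by partitions, and [theta]
    acts on each of them as x - h. In characteristic zero the weights h + l are distinct, so
    polynomials in L_0 separate degrees. The danger is that such a projection loses the part of an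
    element that is highest with respect to [theta]. Since T(c,h) = 0, the element can be chosen so
    that a power of [theta] sends it to the degree zero generator of the socle, on which the
    polynomial acts as a nonzero scalar. The pseudo-trace is intrinsic because [theta] is determined
    by L_0: the Jordan normalization of a family of bases says exactly that [theta] shifts its
    blocks, and endomorphisms commute with L_0, hence with [theta]. *)

Section LinearMaps.
Context {C : fieldType} {V W : lmodType C} (f : V -> W) (Hf : linear f).

Definition linear_of : {linear V -> W} :=
  HB.pack f (GRing.isLinear.Build _ _ _ _ f Hf).

Lemma lin0 : f 0 = 0. Proof. exact: (linear0 linear_of). Qed.
Lemma linD u v : f (u + v) = f u + f v. Proof. exact: (linearD linear_of). Qed.
Lemma linB u v : f (u - v) = f u - f v. Proof. exact: (linearB linear_of). Qed.
Lemma linZ a u : f (a *: u) = a *: f u. Proof. exact: (linearZ_LR linear_of). Qed.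
Lemma lin_sum I (r : seq I) P (F : I -> V) :
  f (\sum_(i <- r | P i) F i) = \sum_(i <- r | P i) f (F i).
Proof. exact: (linear_sum linear_of). Qed.
End LinearMaps.

Section LinearClosure.
Context {C : fieldType} {V W X : lmodType C}.

Lemma linear_id : linear (fun v : V => v). Proof. by []. Qed.
Lemma linear_comp (f : W -> X) (g : V -> W) :
  linear f -> linear g -> linear (fun v => f (g v)).
Proof. by move=> Hf Hg a u v; rewrite Hg Hf. Qed.
Lemma linear_zero : linear (fun _ : V => 0 : W).
Proof. by move=> a u v; rewrite scaler0 addr0. Qed.
Lemma linear_add (f g : V -> W) :
  linear f -> linear g -> linear (fun v => f v + g v).
Proof.
by move=> Hf Hg a u v; rewrite Hf Hg scalerDr !addrA; congr (_ + _); rewrite addrAC.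
Qed.
Lemma linear_scale b (f : V -> W) : linear f -> linear (fun v => b *: f v).
Proof. by move=> Hf a u v; rewrite Hf scalerDr !scalerA mulrC. Qed.
Lemma linear_opp (f : V -> W) : linear f -> linear (fun v => - f v).
Proof. by move=> Hf a u v; rewrite Hf opprD scalerN. Qed.
Lemma linear_sub (f g : V -> W) :
  linear f -> linear g -> linear (fun v => f v - g v).
Proof. by move=> Hf Hg; apply: linear_add => //; apply: linear_opp. Qed.
Lemma linear_sumf I (r : seq I) (F : I -> V -> W) :
  (forall i, linear (F i)) -> linear (fun v => \sum_(i <- r) F i v).
Proof.
move=> HF a u v; rewrite scaler_sumr -big_split /=.
by apply: eq_bigr => i _; rewrite HF.
Qed.
End LinearClosure.

Lemma linear_iter (C : fieldType) (V : lmodType C) (f : V -> V) n :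
  linear f -> linear (iter n f).
Proof. by move=> Hf; elim: n => [|n IHn] a u v //=; rewrite IHn Hf. Qed.

Section Subspaces.
Context {C : fieldType} {W : lmodType C}.
Implicit Types (S : set W) (A B : set W).

Lemma subspaceD S u v : subspace S -> S u -> S v -> S (u + v).
Proof. by move=> [_ HS] Su Sv; have := HS 1 _ _ Su Sv; rewrite scale1r. Qed.
Lemma subspaceZ S a u : subspace S -> S u -> S (a *: u).
Proof. by move=> [S0 HS] Su; have := HS a _ _ Su S0; rewrite addr0. Qed.
Lemma subspaceN S u : subspace S -> S u -> S (- u).
Proof. by move=> HS Su; rewrite -scaleN1r; apply: subspaceZ. Qed.
Lemma subspaceB S u v : subspace S -> S u -> S v -> S (u - v).
Proof. by move=> HS Su Sv; apply: subspaceD => //; apply: subspaceN. Qed.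
Lemma subspace_sum S I (r : seq I) (P : pred I) (F : I -> W) :
  subspace S -> (forall i, P i -> S (F i)) -> S (\sum_(i <- r | P i) F i).
Proof.
move=> HS HF; elim/big_rec: _ => [|i u Pi Su]; first exact: HS.1.
by apply: subspaceD => //; apply: HF.
Qed.
Lemma subspace_sum_seq S (I : eqType) (r : seq I) (F : I -> W) :
  subspace S -> (forall i, i \in r -> S (F i)) -> S (\sum_(i <- r) F i).
Proof.
move=> HS HF; rewrite big_seq; exact: subspace_sum.
Qed.

Lemma subspace_lspan A : subspace (lspan A).
Proof.
split; first by exists [::]; rewrite big_nil.
move=> a u v [s [Hs ->]] [t [Ht ->]].
exists ([seq (a * p.1, p.2) | p <- s] ++ t); split=> [p|].
  by rewrite mem_cat => /orP[/mapP[q /Hs ? ->]|/Ht].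
rewrite big_cat big_map scaler_sumr; congr (_ + _).
by apply: eq_bigr => p _; rewrite scalerA.
Qed.

Lemma lspan_min A S : subspace S -> A `<=` S -> lspan A `<=` S.
Proof.
move=> HS HAS _ [s [Hs ->]]; apply: subspace_sum_seq => // p /Hs /HAS.
exact: subspaceZ.
Qed.

Lemma sub_lspan A : A `<=` lspan A.
Proof.
move=> w Aw; exists [:: (1, w)]; rewrite big_seq1 scale1r; split=> // p.
by rewrite inE => /eqP ->.
Qed.

Lemma subspace_ker (X : lmodType C) (f : W -> X) :
  linear f -> subspace [set w | f w = 0].
Proof.
move=> Hf; split=> [|a u v /= Hu Hv]; first exact: lin0.
by rewrite Hf Hu Hv scaler0 addr0.
Qed.

Lemma subspace_preimage (X : lmodType C) (f : W -> X) (S : set X) :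
  linear f -> subspace S -> subspace [set w | S (f w)].
Proof.
move=> Hf HS; split=> [|a u v /= Hu Hv]; first by rewrite /= lin0 //; exact: HS.1.
by rewrite Hf; apply: HS.2.
Qed.

Lemma subspace_eq (X : lmodType C) (f g : W -> X) :
  linear f -> linear g -> subspace [set w | f w = g w].
Proof.
move=> Hf Hg; split=> [|a u v /= Hu Hv]; first by rewrite /= !lin0.
by rewrite Hf Hg Hu Hv.
Qed.

Lemma subspaceI A B : subspace A -> subspace B -> subspace (A `&` B).
Proof.
move=> HA HB; split; first by split; [exact: HA.1|exact: HB.1].
by move=> a u v [Au Bu] [Av Bv]; split; [exact: HA.2|exact: HB.2].
Qed.

End Subspaces.

(** * Free modules on partitions and the Virasoro action *)

(** Nonincreasing order places the most negative mode leftmost: the monomial of [m :: t] is L_{-m}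
    applied to that of [t]. *)
Definition is_part (s : seq nat) : bool := sorted geq s && all (leq 1) s.

Fixpoint ins (a : nat) (s : seq nat) : seq nat :=
  if s is m :: t then (if m <= a then a :: m :: t else m :: ins a t)%N else [:: a].

Lemma size_ins a s : size (ins a s) = (size s).+1.
Proof. by elim: s => //= m t IH; case: ifP => //= _; rewrite IH. Qed.

Lemma is_part_cons m t :
  is_part (m :: t) = [&& (0 < m)%N, all (geq m) t & is_part t].
Proof.
rewrite /is_part /= (path_sortedE (leT := geq)); last first.
  by move=> x y z /= Hxy Hyz; apply: leq_trans Hxy.
by rewrite -!andbA; do !bool_congr.
Qed.

Lemma all_ins (P : pred nat) a s : all P (ins a s) = P a && all P s.
Proof.
elim: s => //= m t IH; case: ifP => //= _; rewrite IH.
by rewrite !andbA [P m && _]andbC.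
Qed.

Lemma is_part_ins a s : (0 < a)%N -> is_part s -> is_part (ins a s).
Proof.
move=> a0; elim: s => [|m t IH]; first by rewrite /is_part /= a0.
rewrite [ins _ _]/=; case: leqP => Hma Hmt; rewrite is_part_cons.
  rewrite a0 Hmt /= Hma /= andbT; move: Hmt; rewrite is_part_cons.
  case/and3P => _ Ht _; apply: sub_all Ht => y /= Hy; exact: leq_trans Hma.
move: Hmt; rewrite is_part_cons => /and3P[m0 Hm Ht].
by rewrite m0 all_ins Hm IH // andbT /geq /= ltnW.
Qed.

Section FreeModule.
Context {C : fieldType} {U : vectType C}.

Definition part_index : choiceType := ({s : seq nat | is_part s} * 'I_(\dim {:U}))%type.

Definition part_module : lmodType C := {freeg part_index / C}.

(** Stands for the monomial L_{-s} u. The value 0 off partitions makes it total in [s]. *)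
Definition mono (s : seq nat) (u : U) : part_module :=
  if insub s is Some p then
    \sum_j coord (vbasis {:U}) j u *: (<< (p, j) : part_index >> : part_module)
  else 0.

(** Only values on basis vectors of [U] enter, so [ext] is always linear; it agrees with [phi s]
    wherever the latter is linear. *)
Definition ext (N : lmodType C) (phi : seq nat -> U -> N) (w : part_module) : N :=
  fglift (fun k : part_index => phi (val k.1) (vbasis {:U})`_k.2) w.

Lemma linear_mono s : linear (mono s).
Proof.
move=> a u v; rewrite /mono; case: insubP => [p _ _|_]; last by rewrite scaler0 addr0.
rewrite scaler_sumr -big_split /=; apply: eq_bigr => j _.
by rewrite linearP scalerDl scalerA.
Qed.

Lemma linear_fglift (K : choiceType) (N : lmodType C) (f : K -> N) :
  linear (fglift f : {freeg K / C} -> N).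
Proof.
pose F' : {additive {freeg K / C} -> N} :=
  HB.pack (fglift f) (GRing.isAdditive.Build _ _ (fglift f) (lift_is_additive f)).
have [F FE] : exists F : {additive {freeg K / C} -> N}, fglift f =1 F by exists F'.
move=> a D E; rewrite !FE raddfD; congr (_ + _).
rewrite -[in RHS](freeg_sumE D) [a *: D]/(fgscale a D) /fgscale !raddf_sum.
by apply: eq_bigr => z _; rewrite /= -!FE !liftU scalerA.
Qed.

Lemma linear_ext N phi : linear (@ext N phi).
Proof. exact: linear_fglift. Qed.

Lemma ext_mono N phi s u :
  is_part s -> linear (phi s) -> @ext N phi (mono s u) = phi s u.
Proof.
move=> Hs Hphi; rewrite /mono; case: insubP => [p _ ps|]; last by rewrite Hs.
rewrite (lin_sum (linear_ext phi)) {2}(coord_vbasis (memvf u)) (lin_sum Hphi).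
apply: eq_bigr => j _; rewrite (linZ (linear_ext phi)) (linZ Hphi) /ext liftU.
by rewrite scale1r /= ps.
Qed.

Lemma part_module_ind (S : set part_module) :
  subspace S -> (forall s u, is_part s -> S (mono s u)) -> forall w, S w.
Proof.
move=> HS Hm w; rewrite -(freeg_sumE w); apply: subspace_sum => // -[p j] _.
have := Hm (val p) (vbasis {:U})`_j (valP p); rewrite /mono valK.
rewrite (bigD1 j) //= big1 => [|i /negbTE ij].
  rewrite addr0 coord_free ?eqxx ?(basis_free (vbasisP _)) // scale1r => Hpj.
  suff -> : (<< coeff (p, j) w *g (p, j) >> : part_module) =
    coeff (p, j) w *: (<< (p, j) : part_index >> : part_module) by apply: subspaceZ.
  apply/eqP/freeg_eqP => k; rewrite coeffZ !coeffU mul1r //.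
by rewrite coord_free ?(basis_free (vbasisP _)) // eq_sym ij scale0r.
Qed.

Lemma part_module_eq (N : lmodType C) (f g : part_module -> N) :
  linear f -> linear g ->
  (forall s u, is_part s -> f (mono s u) = g (mono s u)) -> f =1 g.
Proof. by move=> Hf Hg; apply: part_module_ind; apply: subspace_eq. Qed.

(** The length filtration, modelled on that of the enveloping algebra. Commutators shorten words, so
    the straightening arguments are inductions along it. *)
Definition short (r : nat) : set part_module :=
  lspan [set w | exists t u, [/\ is_part t, (size t <= r)%N & w = mono t u]].

Lemma short_mono r t u : is_part t -> (size t <= r)%N -> short r (mono t u).
Proof. by move=> Ht Hr; apply: sub_lspan; exists t, u. Qed.

Lemma short_ind r (S : set part_module) : subspace S ->
  (forall s u, is_part s -> (size s <= r)%N -> S (mono s u)) -> short r `<=` S.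
Proof. by move=> HS Hm; apply: lspan_min => // _ [t [u [Ht Hr ->]]]; apply: Hm. Qed.

Lemma short_le r r' : (r <= r')%N -> short r `<=` short r'.
Proof.
move=> Hr; apply: short_ind; first exact: subspace_lspan.
by move=> s u Hs Hsr; apply: short_mono => //; apply: leq_trans Hr.
Qed.
End FreeModule.
Arguments part_module {C} U.

Section Action.
Context {C : fieldType} (c : C) {U : vectType C} (x : U -> U) (Hx : linear x).
Notation N := (part_module U).
Implicit Types (n a b : int) (m r : nat) (s t : seq nat) (u : U).

Definition cocycle (a b : int) : C :=
  if a + b == 0 then (a ^+ 3 - a)%:~R / 12%:R * c else 0.

Definition act_nil n u : N :=
  if n < 0 then mono [:: `|n|%N] u else if n == 0 then mono [::] (x u) else 0.

(** The product in the associated graded algebra, where the modes commute; a mode with n >= 0 does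
    not lengthen the monomial and has no leading term. *)
Definition lead n t u : N := if n < 0 then mono (ins `|n| t) u else 0.

(* Straightening [L_n L_{-m}] into [L_{-m} L_n + [L_n, L_{-m}]] terminates
   since [L_n], up to its leading term [lead n t u], does not increase the
   length of the monomial [t]; [r] bounds the length. *)
Fixpoint act r n : N -> N :=
  ext (fun s u =>
    match s with
    | [::] => act_nil n u
    | m :: t =>
      if n <= - m%:Z then mono (`|n|%N :: m :: t) u else
      match r with
      | 0 => 0
      | r'.+1 =>
        (if n < 0 then mono (m :: ins `|n| t) u else 0)
        + act r' (- m%:Z) (act r' n (mono t u) - lead n t u)
        + (n + m%:Z)%:~R *: act r' (n - m%:Z) (mono t u)
        + cocycle n (- m%:Z) *: mono t u
      end
    end).

Lemma linear_act r n : linear (act r n).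
Proof. case: r => [|r]; exact: linear_ext. Qed.

Lemma linear_act_nil n : linear (act_nil n).
Proof.
rewrite /act_nil; case: (n < 0); first exact: linear_mono.
by case: (n == 0); [apply: linear_comp => //; apply: linear_mono|apply: linear_zero].
Qed.

Lemma linear_lead n t : linear (lead n t).
Proof. by rewrite /lead; case: (n < 0); [exact: linear_mono|exact: linear_zero]. Qed.

Lemma act_nilE r n u : act r n (mono [::] u) = act_nil n u.
Proof. by case: r => [|r] /=; rewrite ext_mono //; apply: linear_act_nil. Qed.

Lemma act_head r n m t u : is_part (m :: t) -> n <= - m%:Z ->
  act r n (mono (m :: t) u) = mono (`|n|%N :: m :: t) u.
Proof.
by move=> Ht Hn; case: r => [|r] /=; rewrite ext_mono // Hn //; apply: linear_mono.
Qed.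

Lemma act_cons r n m t u : is_part (m :: t) -> - m%:Z < n ->
  act r.+1 n (mono (m :: t) u) =
        (if n < 0 then mono (m :: ins `|n| t) u else 0)
        + act r (- m%:Z) (act r n (mono t u) - lead n t u)
        + (n + m%:Z)%:~R *: act r (n - m%:Z) (mono t u)
        + cocycle n (- m%:Z) *: mono t u.
Proof.
move=> Ht Hn; rewrite [LHS]/= ext_mono //=; first by rewrite leNgt Hn.
rewrite leNgt Hn /=.
do !apply: linear_add; do ?apply: linear_scale.
- by case: (n < 0); [apply: linear_mono|apply: linear_zero].
- apply: linear_comp; first exact: linear_act.
  apply: linear_sub (linear_lead _ _).
  by apply: linear_comp; [apply: linear_act|apply: linear_mono].
- by apply: linear_comp; [apply: linear_act|apply: linear_mono].
- exact: linear_mono.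
Qed.

(** In [act] the leading term is subtracted before L_{-m} is applied recursively and is restored by
    hand with [m] prepended. All other terms of the recursion therefore stay within the length
    bound. *)
Lemma short_act_lead r n t u : is_part t -> (size t <= r)%N ->
  short (size t) (act r n (mono t u) - lead n t u).
Proof.
have short0 q : short q (0 : N) by apply: (subspace_lspan _).1.
elim: r n t u => [|r IH] n [|m t] u Ht Hr //.
- rewrite act_nilE /act_nil /lead; case: ifP => Hn; first by rewrite subrr.
  by rewrite subr0; case: ifP => _ //; apply: short_mono.
- rewrite act_nilE /act_nil /lead; case: ifP => Hn; first by rewrite subrr.
  by rewrite subr0; case: ifP => _ //; apply: short_mono.
(* One mode lengthens words by at most one, the extra factor coming from the leading term. *)
have act_short q a w : (q <= r)%N -> short q w -> short q.+1 (act r a w).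
  move=> Hq; move: w; apply: short_ind.
    by apply: subspace_preimage; [apply: linear_act|apply: subspace_lspan].
  move=> s v Hs Hsq; rewrite -[act _ _ _](subrK (lead a s v)).
  apply: subspaceD; first exact: subspace_lspan.
    by apply: short_le (IH a s v Hs _); lia.
  rewrite /lead; case: ifP => Ha; last exact: short0.
  by apply: short_mono; [apply: is_part_ins => //; lia|rewrite size_ins].
have Ht' : is_part t by move: Ht; rewrite is_part_cons => /and3P[].
case: (leP n (- m%:Z)) => Hn.
  rewrite act_head // /lead ifT; last by move: Ht; rewrite is_part_cons; lia.
  rewrite [ins _ _]/= ifT ?subrr //; lia.
rewrite act_cons //.
have -> : lead n (m :: t) u = if n < 0 then mono (m :: ins `|n| t) u else 0.
  rewrite /lead; case: ifP => // Hn0; rewrite [ins _ _]/= ifF //; lia.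
set A := (if _ then _ else _); rewrite -!addrA addrC -!addrA addNr addr0.
have HS := subspace_lspan; apply: subspaceD; first exact: HS.
  by apply: act_short => //; apply: IH.
apply: subspaceD; first exact: HS.
  by apply: subspaceZ; [apply: HS|apply: act_short => //; apply: short_mono].
by apply: subspaceZ; [apply: HS|apply: short_mono => //; apply: leqW].
Qed.

(** By [short_act_lead] every recursive call receives an argument within its bound, so the bound
    does not affect the value and [Lpart] may use the length itself. *)
Lemma act_stable r r' n t u : is_part t -> (size t <= r)%N -> (size t <= r')%N ->
  act r n (mono t u) = act r' n (mono t u).
Proof.
elim: r r' n t u => [|r IH] [|r'] n [|m t] u Ht Hr Hr' //; rewrite ?act_nilE //.
have Ht' : is_part t by move: Ht; rewrite is_part_cons => /and3P[].
case: (leP n (- m%:Z)) => Hn; first by rewrite !act_head.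
rewrite !act_cons // !(IH r') //; do 3!congr (_ + _).
have : short (size t) (act r' n (mono t u) - lead n t u) by apply: short_act_lead.
move: (_ - _); apply: short_ind.
  by apply: subspace_eq; apply: linear_act.
by move=> s v Hs Hst; apply: IH => //; apply: leq_trans Hst _.
Qed.

Definition Lpart n : N -> N := ext (fun s u => act (size s) n (mono s u)).

Lemma linear_Lpart n : linear (Lpart n). Proof. exact: linear_ext. Qed.

Lemma Lpart_act r n t u : is_part t -> (size t <= r)%N ->
  Lpart n (mono t u) = act r n (mono t u).
Proof.
move=> Ht Hr; rewrite /Lpart ext_mono //; first exact: act_stable.
by apply: linear_comp; [apply: linear_act|apply: linear_mono].
Qed.

Lemma Lpart_nil n u : Lpart n (mono [::] u) = act_nil n u.
Proof. by rewrite (@Lpart_act 0) // act_nilE. Qed.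

Lemma Lpart_head m t u : is_part (m :: t) ->
  Lpart (- m%:Z) (mono t u) = mono (m :: t) u.
Proof.
move=> Hmt; move: (Hmt); rewrite is_part_cons => /and3P[m0 Hm Ht].
rewrite (Lpart_act _ _ Ht (leqnn _)); case: t Hmt Hm Ht => [|p t] Hmt Hm Ht.
  by rewrite act_nilE /act_nil ifT ?abszN ?absz_nat //; lia.
rewrite act_head //; first by rewrite abszN absz_nat.
by move: Hm => /= /andP[/= + _]; lia.
Qed.

Lemma Lpart_lead n t u : is_part t ->
  short (size t) (Lpart n (mono t u) - lead n t u).
Proof. by move=> Ht; rewrite (Lpart_act _ _ Ht (leqnn _)); apply: short_act_lead. Qed.

Lemma Lpart_cons n m t u : is_part (m :: t) -> - m%:Z < n ->
  Lpart n (mono (m :: t) u) =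
    Lpart (- m%:Z) (Lpart n (mono t u))
    + (n + m%:Z)%:~R *: Lpart (n - m%:Z) (mono t u)
    + cocycle n (- m%:Z) *: mono t u.
Proof.
move=> Hmt Hn; move: (Hmt); rewrite is_part_cons => /and3P[m0 Hm Ht].
rewrite (Lpart_act _ _ Hmt (leqnn _)) act_cons //.
rewrite !(Lpart_act _ _ Ht (leqnn _)); congr (_ + _ + _).
rewrite -[in RHS](subrK (lead n t u) (act _ n _)) [in RHS]addrC (linD (linear_Lpart _)).
congr (_ + _).
  rewrite /lead; case: ifP => Hn0; last by rewrite lin0 //; apply: linear_Lpart.
  rewrite Lpart_head // is_part_cons m0 is_part_ins ?andbT //=; last by lia.
  rewrite all_ins Hm andbT /geq /=; lia.
have := short_act_lead n u Ht (leqnn _); move: (_ - _); apply: short_ind.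
  by apply: subspace_eq; [apply: linear_act|apply: linear_Lpart].
by move=> s v Hs Hst; rewrite -Lpart_act.
Qed.
End Action.

Lemma cocycle_anti (C : fieldType) (c : C) a b : cocycle c b a = - cocycle c a b.
Proof.
rewrite /cocycle addrC; case: eqP => [ab|]; last by rewrite oppr0.
have -> : b = - a by lia.
rewrite -!mulNr -rmorphN; congr (_%:~R / _ * _); ring.
Qed.

Lemma cocycle_refl (C : fieldType) (c : C) a : cocycle c a a = 0.
Proof.
rewrite /cocycle; case: eqP => // aa; have -> : a = 0 by lia.
by rewrite expr0n subrr !mul0r.
Qed.

(** The 2-cocycle condition for the triple L_a, L_b, L_{-m}; off the line a + b = m all terms
    vanish. *)
Lemma cocycle_jacobi (C : fieldType) (c : C) (a b m : int) :
  (a + m)%:~R * cocycle c (a - m) b - (b + m)%:~R * cocycle c (b - m) a =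
  (a - b)%:~R * cocycle c (a + b) (- m).
Proof.
rewrite /cocycle addrAC [b - m + a]addrAC [b + a]addrC.
case: eqP => [abm|]; last by rewrite !mulr0 subr0.
have -> : m = a + b by lia.
rewrite !mulrA -!rmorphM -!mulrBl -rmorphB; congr (_%:~R / _ * _); ring.
Qed.

(** * The Virasoro relations on the model *)

Section Bracket.
Context {C : fieldType} (c : C) {U : vectType C} (x : U -> U) (Hx : linear x).
Notation N := (part_module U).
Notation L := (Lpart c x).
Implicit Types (a b : int) (m : nat) (s t : seq nat) (u : U) (w : N).

Definition virasoro_rel a b w : Prop :=
  L a (L b w) - L b (L a w) = (a - b)%:~R *: L (a + b) w + cocycle c a b *: w.

Lemma subspace_rel a b : subspace (virasoro_rel a b).
Proof.
have HL n := linear_Lpart c x n.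
apply: subspace_eq; last first.
  by apply: linear_add; apply: linear_scale => //; apply: linear_id.
by apply: linear_sub; apply: linear_comp.
Qed.

Lemma rel_anti a b w : virasoro_rel a b w -> virasoro_rel b a w.
Proof.
rewrite /virasoro_rel => Hab; rewrite -opprB Hab opprD -!scaleNr cocycle_anti opprK.
by rewrite -rmorphN opprB [b + a]addrC (cocycle_anti c a b).
Qed.

Lemma rel_refl a w : virasoro_rel a a w.
Proof. by rewrite /virasoro_rel !subrr scale0r cocycle_refl scale0r addr0. Qed.

(** When L_{-m} can be prepended to [t], the relation is the recursion [Lpart_cons] read
    backwards. *)
Lemma rel_head a m t u : is_part (m :: t) -> - m%:Z <= a ->
  virasoro_rel a (- m%:Z) (mono t u).
Proof.
move=> Hmt; rewrite le_eqVlt => /predU1P[<-|Ha]; first exact: rel_refl.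
rewrite /virasoro_rel Lpart_head // Lpart_cons // opprK -!addrA [X in X = _]addrC.
by rewrite -!addrA addNr addr0.
Qed.

Lemma rel_nil a b u : virasoro_rel a b (mono [::] u).
Proof.
wlog ba : a b / b <= a => [H|].
  by case: (leP b a) => ab; [apply: H|apply/rel_anti/H/ltW].
case: (ltP b 0) => b0.
  have -> : b = - `|b|%N%:Z by lia.
  by apply: rel_head; [rewrite /is_part /=; lia|lia].
case: (eqVneq a b) => [<-|ab]; first exact: rel_refl.
have L0 n v : 0 < n -> L n (mono [::] v) = 0.
  by move=> n0; rewrite Lpart_nil // /act_nil; do 2![rewrite ifF; last by lia].
rewrite /virasoro_rel (L0 a) ?(L0 (a + b)); do ?lia.
rewrite (lin0 (linear_Lpart _ _ _)) scaler0 subr0 add0r /cocycle ifF ?scale0r; last by lia.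
rewrite Lpart_nil // /act_nil ifF; last by lia.
case: ifP => _; first by rewrite L0 //; lia.
by rewrite (lin0 (linear_Lpart _ _ _)).
Qed.

Lemma part_module_coeffP v w : (forall k, coeff k v = coeff k w) -> v = w :> N.
Proof. by move=> H; apply/eqP/freeg_eqP. Qed.

(* Humphreys' argument for the Poincare-Birkhoff-Witt theorem: if neither [a]
   nor [b] can be prepended to [s = m :: t], write the monomial as [L_{-m}]
   applied to a shorter one; by induction all commutators with [L_{-m}] are
   known, and the claim becomes the Jacobi identity. *)
Lemma rel_mono a b s u : is_part s -> virasoro_rel a b (mono s u).
Proof.
have [r] := ubnP (size s); elim: r => // r IH in a b s u *; rewrite ltnS => Hr Hs.
case: s Hr Hs => [|m t] Hr Hs; first exact: rel_nil.
wlog ba : a b / b <= a => [H|].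
  by case: (leP b a) => ab; [apply: H|apply/rel_anti/H/ltW].
case: (leP b (- m%:Z)) => bm.
  have m0 : (0 < m)%N by move: Hs; rewrite is_part_cons => /and3P[].
  have -> : b = - `|b|%N%:Z by lia.
  apply: rel_head; last by lia.
  rewrite is_part_cons Hs andbT /=; move: (Hs); rewrite is_part_cons.
  case/and3P => _ Ht _; apply/and3P; split; do ?by rewrite /geq /=; lia.
  by apply: sub_all Ht => y /= Hy; apply: leq_trans Hy _; lia.
move: (Hs); rewrite is_part_cons => /and3P[m0 Hm Ht].
have IHs a' b' w : short (size t) w -> virasoro_rel a' b' w.
  move: w; apply: short_ind; first exact: subspace_rel.
  by move=> v u' Hv Hvt; apply: IH => //; apply: leq_ltn_trans Hvt _.
(* L_{b'} of [t] is a short part, covered by induction, plus a leading monomial to which L_{-m} can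
   be prepended because [m] exceeds all its entries or equals them. *)
have key a' b' : - m%:Z < a' -> - m%:Z < b' ->
    virasoro_rel a' (- m%:Z) (L b' (mono t u)).
  move=> Ha' Hb'; rewrite -(subrK (lead b' t u) (L b' _)).
  apply: subspaceD; first exact: subspace_rel.
    exact/IHs/Lpart_lead.
  rewrite /lead; case: ifP => b0; last exact: (subspace_rel _ _).1.
  apply: rel_head (ltW Ha'); rewrite is_part_cons m0 all_ins Hm is_part_ins //; last by lia.
  by rewrite /geq /= !andbT; lia.
have e_short : short (size t) (mono t u) by apply: short_mono.
have Ha : - m%:Z < a by lia.
have HLD n := linD (linear_Lpart c x n).
have HLZ n := linZ (linear_Lpart c x n).
have H1 := IHs b (- m%:Z) _ e_short; have H2 := IHs a (- m%:Z) _ e_short.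
have H3 := key a b Ha bm; have H4 := key b a bm Ha.
have H5 := IHs (a - m%:Z) b _ e_short; have H6 := IHs (b - m%:Z) a _ e_short.
have H7 := IHs a b _ e_short; have H8 := IHs (a + b) (- m%:Z) _ e_short.
have J := cocycle_jacobi c a b m%:Z.
move: H1 H2 H3 H4 H5 H6 H7 H8; rewrite /virasoro_rel -(Lpart_head c Hx u Hs).
set y := L (- m%:Z); set e := mono t u; rewrite !opprK.
have sub (A B D : N) : A - B = D -> A = D + B by move=> <-; rewrite subrK.
move=> /sub H1 /sub H2 /sub H3 /sub H4 /sub H5 /sub H6 /sub H7 /sub H8.
have yD (u1 u2 : N) : y (u1 + u2) = y u1 + y u2 by exact: (HLD (- m%:Z) u1 u2).
have yZ k (u1 : N) : y (k *: u1) = k *: y u1 by exact: (HLZ (- m%:Z) k u1).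
rewrite H1 H2 H8 !HLD !HLZ H3 H4 H5 H6 H7 !(yD, yZ).
rewrite [b - m%:Z + a]addrAC [b + a]addrC [a - m%:Z + b]addrAC.
move: J; move: (L (a + b - m%:Z) e) (L b (L (a - m%:Z) e)) (L a (L (b - m%:Z) e)).
move: (L (a - m%:Z) (L b e)) (L b e) (L a e) (y e) (y (L b (L a e))) (y (L (a + b) e)).
clear -C => v1 v2 v3 v4 v5 v6 v7 v8 v9 J.
(* Coefficient by coefficient, the claim is a polynomial identity in the field modulo the cocycle
   identity [J]. *)
apply: part_module_coeffP => k.
rewrite !(coeffD, coeffB, coeffN, coeffZ).
apply/eqP; rewrite -subr_eq0; move/eqP: J; rewrite -subr_eq0 => /eqP J.
by rewrite -[0](mul0r (coeff k e)) -J; apply/eqP; ring.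
Qed.

Lemma virasoro_Lpart : virasoro_module c L.
Proof.
split=> [n|a b]; first exact: linear_Lpart.
apply: part_module_ind; first exact: (subspace_rel a b).
by move=> s u; apply: rel_mono.
Qed.
End Bracket.

(** Convertible with the [foldr] inside [degree_space]. *)
Definition word (C : fieldType) (M : lmodType C) (L : int -> M -> M)
    (s : seq nat) (w : M) : M :=
  foldr (fun n v => L (- n%:Z) v) w s.

Section Words.
Context {C : fieldType} {M : lmodType C} (L : int -> M -> M).
Hypothesis HL : forall n, linear (L n).

Lemma linear_word s : linear (word L s).
Proof.
elim: s => [|n s IH]; first exact: linear_id.
exact: linear_comp.
Qed.

Lemma word_hom (N : lmodType C) (L' : int -> N -> N) (f : M -> N) s w :
  (forall n w, f (L n w) = L' n (f w)) -> f (word L s w) = word L' s (f w).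
Proof. by move=> Hf; elim: s => //= n s <-. Qed.
End Words.

(** * Universal property of the model and the Poincare-Birkhoff-Witt theorem *)

Section Universal.
Context {C : fieldType} (c : C) {U : vectType C} (x : U -> U) (Hx : linear x).
Notation N := (part_module U).
Notation L := (Lpart c x).

Lemma word_mono s u : is_part s -> word L s (mono [::] u) = mono s u.
Proof.
elim: s => //= n s IH Hs; rewrite IH ?Lpart_head //.
by move: Hs; rewrite is_part_cons => /and3P[].
Qed.

Lemma degree_zero_mono : degree_zero_map x L (mono [::]).
Proof.
split=> [|n u n0|u]; first exact: linear_mono.
  by rewrite Lpart_nil // /act_nil; do 2![rewrite ifF; last by lia].
by rewrite Lpart_nil // /act_nil ltxx eqxx.
Qed.

Section Hom.
Context {M : lmodType C} (L' : int -> M -> M) (g : U -> M).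
Hypotheses (HL' : virasoro_module c L') (Hg : degree_zero_map x L' g).

Definition part_hom : N -> M := ext (fun s u => word L' s (g u)).

Lemma linear_part_hom : linear part_hom. Proof. exact: linear_ext. Qed.

Lemma part_hom_mono s u : is_part s -> part_hom (mono s u) = word L' s (g u).
Proof.
case: HL' Hg => HL _ [Hlin _ _] Hs; rewrite /part_hom ext_mono //.
by apply: linear_comp => //; apply: linear_word.
Qed.

(** Induction on length. If L_n can be prepended the claim is the definition of [part_hom];
    otherwise both sides expand by the commutator of L_n with L_{-m}, and the leading term is again
    a monomial that admits L_{-m} in front. *)
Lemma part_hom_L n w : part_hom (L n w) = L' n (part_hom w).
Proof.
case: HL' Hg => HL rel [Hlin gpos g0]; have Hp := linear_part_hom.
move: w; apply: part_module_ind.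
  by apply: subspace_eq; apply: linear_comp => //; apply: linear_Lpart.
move=> s u; have [r] := ubnP (size s); elim: r => // r IH in n s u *; rewrite ltnS.
case: s => [|m t] Hr Hs.
  rewrite Lpart_nil // part_hom_mono //= /act_nil; case: ifP => n0.
    rewrite part_hom_mono /=; last by rewrite /is_part /=; lia.
    by congr (L' _ _); lia.
  case: eqP => [->|nN0]; first by rewrite part_hom_mono //= g0.
  by rewrite gpos; [rewrite lin0|lia].
have IHs n' w : short (size t) w -> part_hom (L n' w) = L' n' (part_hom w).
  move: w; apply: short_ind.
    by apply: subspace_eq; apply: linear_comp => //; apply: linear_Lpart.
  by move=> v u' Hv Hvt; apply: IH => //; apply: leq_ltn_trans Hvt _.
move: (Hs); rewrite is_part_cons => /and3P[m0 Hm Ht].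
case: (leP n (- m%:Z)) => nm.
  have nE : n = - `|n|%N%:Z by lia.
  have Hn : is_part (`|n|%N :: m :: t).
    rewrite is_part_cons Hs andbT /=; apply/and3P; split; do ?by rewrite /geq /=; lia.
    by apply: sub_all Hm => y /= Hy; apply: leq_trans Hy _; lia.
  by rewrite {1}nE Lpart_head // !part_hom_mono //= -nE.
have et : short (size t) (mono t u) by apply: short_mono.
have := rel n (- m%:Z) (part_hom (mono t u)).
rewrite [part_hom (mono (m :: t) u)]part_hom_mono //= -(part_hom_mono u Ht).
move/eqP; rewrite subr_eq => /eqP ->.
rewrite Lpart_cons // !(linD Hp) !(linZ Hp) !opprK -addrA (IHs _ _ et) [RHS]addrC.
congr (_ + _).
rewrite -(IHs _ _ et) -(subrK (lead n t u) (L n (mono t u))).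
rewrite (linD (linear_Lpart _ _ _)) !(linD Hp) (linD (HL _)); congr (_ + _).
  rewrite -(linD Hp); exact/IHs/Lpart_lead.
rewrite /lead; case: ifP => n0; last by rewrite !lin0 //; apply: linear_Lpart.
rewrite Lpart_head ?part_hom_mono ?is_part_ins //=; try lia.
  by rewrite is_part_cons m0 all_ins Hm is_part_ins //= /geq /=; lia.
by rewrite is_part_cons m0 all_ins Hm is_part_ins //= /geq /=; lia.
Qed.
End Hom.

Lemma induced_part_module : induced_module c x L (mono [::]).
Proof.
split; [exact: virasoro_Lpart|exact: degree_zero_mono|].
move=> M L' g HL' Hg; exists (part_hom L' g); split.
  split; [exact: linear_part_hom|exact: part_hom_L|].
  by move=> u; rewrite part_hom_mono.
move=> f [Hf fL fg]; apply/funext; apply: part_module_eq => //.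
  exact: linear_part_hom.
move=> s u Hs; rewrite part_hom_mono // -word_mono // (word_hom _ _ fL).
by rewrite fg.
Qed.

(** The two universal properties give maps [f] to the model and [g] back, and uniqueness for [M]
    forces g o f = id. Spanning is pushed forward along [g], the coefficient functions [gamma t] are
    pulled back along [f]. *)
Lemma PBW (M : lmodType C) (LM : int -> M -> M) (i : U -> M) :
  induced_module c x LM i ->
  (forall w, lspan [set w | exists s u, is_part s /\ w = word LM s (i u)] w) /\
  exists gamma : seq nat -> M -> U,
    (forall t, linear (gamma t)) /\
    forall s t u, is_part s -> is_part t ->
      gamma t (word LM s (i u)) = if s == t then u else 0.
Proof.
move=> [HLM Hi HM]; have [VN DN HN] := induced_part_module.
have [f [[Hf fL fi] _]] := HM _ _ _ VN DN.
have [g [[Hg gL gi] _]] := HN _ _ _ HLM Hi.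
have gf_id : (fun w => g (f w)) = id.
  have [e [_ He]] := HM _ _ _ HLM Hi.
  rewrite -(He id) //; apply/esym/He; split; first exact: linear_comp.
    by move=> n v; rewrite fL gL.
  by move=> u; rewrite fi gi.
have gf w : g (f w) = w := congr1 (@^~ w) gf_id.
split=> [w|].
  rewrite -(gf w); move: (f w); apply: part_module_ind.
    by apply: subspace_preimage => //; apply: subspace_lspan.
  move=> s u Hs; apply: sub_lspan; exists s, u; split=> //.
  by rewrite -word_mono // (word_hom _ _ gL) gi.
have lin_t t s : linear (fun u : U => if s == t then u else 0).
  by case: (s == t); [exact: linear_id|exact: linear_zero].
exists (fun t w => ext (fun s u => if s == t then u else 0) (f w)); split=> [t|].
  by apply: linear_comp => //; apply: linear_ext.
by move=> s t u Hs Ht; rewrite (word_hom _ _ fL) fi word_mono // ext_mono.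
Qed.
End Universal.

(** * Jordan chains *)

Section JordanChain.
Context {C : fieldType} {U : lmodType C} (eps : U -> U) (k : nat) (e : nat -> U).

(** Indexed from 0, so that [e b] is killed by exactly the powers of [eps] above [b]. Independence
    follows from [e 0 <> 0] in [chain_free]. *)
Definition jordan_chain : Prop :=
  [/\ linear eps, forall v, exists a : nat -> C, v = \sum_(b < k) a b *: e b,
      e 0%N <> 0, eps (e 0%N) = 0 &
      forall b, (b.+1 < k)%N -> eps (e b.+1) = e b].

Hypothesis Hj : jordan_chain.

Let lin_eps : linear eps. Proof. by case: Hj. Qed.

Lemma iter_chain m b : (b < k)%N ->
  iter m eps (e b) = if (m <= b)%N then e (b - m)%N else 0.
Proof.
case: Hj => _ _ _ e0 eS Hb; elim: m => [|m IH] /=; first by rewrite subn0.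
rewrite IH; case: ltngtP => [mb|bm|<-]; last by rewrite subnn.
- by rewrite -[X in e X](subnSK mb) eS //; lia.
- by rewrite lin0.
Qed.

Lemma iter_chain_top m (a : nat -> C) : (m < k)%N ->
  iter m eps (\sum_(b < m.+1) a b *: e b) = a m *: e 0%N.
Proof.
move=> mk; rewrite (lin_sum (linear_iter m lin_eps)) big_ord_recr /= big1 => [|b _].
  by rewrite add0r (linZ (linear_iter m lin_eps)) iter_chain // leqnn subnn.
have bm := ltn_ord b; rewrite (linZ (linear_iter m lin_eps)) iter_chain; last by lia.
by rewrite ifF ?scaler0 //; lia.
Qed.

Lemma iter_chain_gt m (a : nat -> C) : (m <= k)%N ->
  iter m eps (\sum_(b < m) a b *: e b) = 0.
Proof.
move=> mk; rewrite (lin_sum (linear_iter m lin_eps)) big1 // => b _.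
have bm := ltn_ord b; rewrite (linZ (linear_iter m lin_eps)) iter_chain; last by lia.
by rewrite ifF ?scaler0 //; lia.
Qed.

Lemma iter_eps0 v : iter k eps v = 0.
Proof. by case: Hj => _ /(_ v)[a ->] _ _ _; apply: iter_chain_gt. Qed.

Lemma iter_eps_le m n v : (m <= n)%N -> iter m eps v = 0 -> iter n eps v = 0.
Proof. by move=> /subnK <- Hv; rewrite iterD Hv; apply/lin0/linear_iter. Qed.

Lemma chain_scale0 (a : C) : a *: e 0%N = 0 -> a = 0.
Proof. by case: Hj => _ _ /eqP He _ _ /eqP; rewrite scaler_eq0 (negbTE He) orbF => /eqP. Qed.

(** The power [eps ^ m] isolates the coefficient of [e m] in a combination of [e 0], ..., [e m]; the
    coefficients from the top down to index [j] thus vanish one at a time. *)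
Lemma ker_chain j v : (j <= k)%N -> iter j eps v = 0 ->
  exists a : nat -> C, v = \sum_(b < j) a b *: e b.
Proof.
move=> jk Hv; suff H m : (m <= k - j)%N ->
    exists a : nat -> C, v = \sum_(b < k - m) a b *: e b.
  by have := H _ (leqnn _); rewrite subKn.
elim: m => [|m IH] Hm; first by rewrite subn0; case: Hj.
have [a Ha] := IH (ltnW Hm); exists a.
have Em : (k - m = (k - m.+1).+1)%N by lia.
have : iter (k - m.+1) eps v = 0 by apply: iter_eps_le Hv; lia.
rewrite Ha Em iter_chain_top; last by lia.
by move/chain_scale0 => a0; rewrite big_ord_recr /= a0 scale0r addr0.
Qed.

Lemma chain_free m (a : nat -> C) : (m <= k)%N -> \sum_(b < m) a b *: e b = 0 ->
  forall b, (b < m)%N -> a b = 0.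
Proof.
elim: m => // m IH mk Ha b.
have am : a m = 0.
  apply: chain_scale0; rewrite -iter_chain_top // Ha.
  exact/lin0/linear_iter.
rewrite ltnS leq_eqVlt => /predU1P[-> //|]; apply: IH; first exact: ltnW.
by move: Ha; rewrite big_ord_recr /= am scale0r addr0.
Qed.

(** On such a vector the nilpotent [eps] acts as the nonzero scalar -a. *)
Lemma eps_add_inj a v : a <> 0 -> eps v + a *: v = 0 -> v = 0.
Proof.
move=> /eqP a0 /eqP; rewrite addr_eq0 -scaleNr => /eqP Hv.
have Hm m : iter m eps v = (- a) ^+ m *: v.
  elim: m => [|m /= ->]; first by rewrite scale1r.
  by rewrite (linZ lin_eps) Hv scalerA exprSr.
have := Hm k; rewrite iter_eps0 => /esym/eqP; rewrite scaler_eq0 expf_eq0 oppr_eq0.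
by rewrite (negbTE a0) andbF => /eqP.
Qed.

Lemma iter_eps_add_inj n a v : a <> 0 ->
  iter n (fun v => eps v + a *: v) v = 0 -> v = 0.
Proof. by move=> a0; elim: n v => //= n IH v /(eps_add_inj a0); apply: IH. Qed.
End JordanChain.

(** * Structure of the induced modules *)

Section InducedCoordinates.
Context {C : fieldType} (c : C) {U : vectType C} (x : U -> U) (Hx : linear x).
Context {W : lmodType C} (L : int -> W -> W) (i : U -> W).
Hypothesis hW : induced_module c x L i.

Lemma linear_L n : linear (L n). Proof. by case: hW => -[H]. Qed.
Lemma linear_i : linear i. Proof. by case: hW => _ []. Qed.

Definition pbw_coord : seq nat -> W -> U := projT1 (cid (PBW Hx hW).2).

Lemma linear_coord t : linear (pbw_coord t).
Proof. by rewrite /pbw_coord; case: cid => g [] /=. Qed.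

Lemma coord_word s t u : is_part s -> is_part t ->
  pbw_coord t (word L s (i u)) = if s == t then u else 0.
Proof. by rewrite /pbw_coord; case: cid => g [_ H] /=; apply: H. Qed.

Lemma induced_ind (S : set W) : subspace S ->
  (forall s u, is_part s -> S (word L s (i u))) -> forall w, S w.
Proof.
move=> HS H w; have [Hw _] := PBW Hx hW; apply: lspan_min (Hw w) => // _ [s [u [Hs ->]]].
exact: H.
Qed.

Lemma induced_eq (X : lmodType C) (f g : W -> X) : linear f -> linear g ->
  (forall s u, is_part s -> f (word L s (i u)) = g (word L s (i u))) -> f =1 g.
Proof. by move=> Hf Hg; apply: induced_ind; apply: subspace_eq. Qed.

(** The partitions in a spanning expression are collected into a duplicate-free list; by linearity
    the coefficients are then the coordinates. *)
Lemma pbw_decomp w : exists r : seq (seq nat),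
  [/\ all is_part r, uniq r & w = \sum_(s <- r) word L s (i (pbw_coord s w))].
Proof.
have [r [Hr Ur Hw]] : exists r : seq (seq nat), [/\ all is_part r, uniq r &
    lspan [set w | exists s u, s \in r /\ w = word L s (i u)] w].
  have [/(_ w) [q [Hq ->]] _] := PBW Hx hW.
  elim: q Hq => [|p q IH] Hq.
    by exists [::]; split=> //; rewrite big_nil; apply: (subspace_lspan _).1.
  have [r [Hr Ur Hw]] := IH (fun p' Hp' => Hq p' (mem_behead (s := p :: q) Hp')).
  have [s [u [Hs Ep]]] := Hq p (mem_head _ _).
  exists (undup (s :: r)); rewrite undup_uniq; split=> //.
    by apply/allP => t; rewrite mem_undup inE => /predU1P[->|/(allP Hr)].
  rewrite big_cons; apply: subspaceD; first exact: subspace_lspan.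
    apply: subspaceZ; first exact: subspace_lspan.
    by apply: sub_lspan; exists s, u; rewrite mem_undup mem_head.
  move: Hw; apply: lspan_min; first exact: subspace_lspan.
  move=> _ [t [v [tr ->]]]; apply: sub_lspan; exists t, v.
  by rewrite mem_undup inE tr orbT.
exists r; split=> //; move: w Hw; apply: lspan_min.
  apply: subspace_eq; first exact: linear_id.
  apply: linear_sumf => s; apply: linear_comp; first exact/linear_word/linear_L.
  by apply: linear_comp; [exact: linear_i|exact: linear_coord].
move=> _ [s [u [sr ->]]] /=; rewrite (bigD1_seq s) //= big_seq_cond big1 => [|t].
  by rewrite coord_word ?(allP Hr _ sr) // eqxx addr0.
case/andP => tr /negbTE ts; rewrite coord_word ?(allP Hr _ _) // eq_sym ts.
by rewrite (lin0 linear_i) (lin0 (linear_word linear_L _)).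
Qed.

Lemma coord_inj w : (forall t, is_part t -> pbw_coord t w = 0) -> w = 0.
Proof.
move=> H; have [r [Hr _ ->]] := pbw_decomp w.
rewrite big_seq big1 // => s /(allP Hr)/H ->.
by rewrite (lin0 linear_i) (lin0 (linear_word linear_L _)).
Qed.

Lemma coord_i u : pbw_coord [::] (i u) = u.
Proof. by rewrite (@coord_word [::]). Qed.

Lemma word_submodule S s w : submodule L S -> S w -> S (word L s w).
Proof. by move=> [_ HS] Sw; elim: s => //= n s; apply: HS. Qed.

Lemma submodule_span (S : set W) w : submodule L S ->
  (forall t, is_part t -> S (i (pbw_coord t w))) -> S w.
Proof.
move=> HS H; have [r [Hr _ ->]] := pbw_decomp w.
apply: subspace_sum_seq; first exact: HS.1.
by move=> s /(allP Hr)/H; apply: word_submodule.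
Qed.

Lemma L0_word s w : L 0 (word L s w) = word L s (L 0 w) + (sumn s)%:R *: word L s w.
Proof.
case: hW => -[_ rel] _ _; elim: s => [|n s IH] /=; first by rewrite scale0r addr0.
have := rel 0 (- n%:Z) (word L s w); move/eqP; rewrite subr_eq => /eqP ->.
rewrite IH !(linD (linear_L _)) !(linZ (linear_L _)) add0r sub0r opprK.
have -> : (if - n%:Z == 0 then (0 ^+ 3 - 0)%:~R / 12%:R * c else 0) = 0 :> C.
  by case: ifP => // _; rewrite expr0n subrr !mul0r.
rewrite scale0r addr0 addrCA -scalerDl natrD; congr (_ + _ *: _).
Qed.

Lemma coord_L0 t w : is_part t ->
  pbw_coord t (L 0 w) = x (pbw_coord t w) + (sumn t)%:R *: pbw_coord t w.
Proof.
move=> Ht; have Hc := linear_coord t; move: w; apply: induced_eq.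
- by apply: linear_comp Hc (linear_L 0).
- by apply: linear_add; [apply: linear_comp|apply: linear_scale].
move=> s u Hs; rewrite L0_word (linD Hc) (linZ Hc).
case: hW => _ [_ _ ->] _; rewrite !coord_word //.
by case: eqP => [->//|_]; rewrite (lin0 Hx) !scaler0.
Qed.

End InducedCoordinates.

(** * The nilpotent part of L_0 and the classification of submodules *)

Section Uniserial.
Context {C : numFieldType} (c h : C) (k : nat) (k_gt0 : (0 < k)%N).
Context {U : vectType C} (x : U -> U) (Hx : linear x).
Context {W : lmodType C} (L : int -> W -> W) (i : U -> W).
Hypothesis hW : induced_module c x L i.
Context (e : nat -> U).
Notation eps := (fun u => x u - h *: u).
Hypothesis He : jordan_chain eps k e.

Notation gamma := (pbw_coord Hx hW).
Let linL n : linear (L n) := linear_L hW n.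
Let lini : linear i := linear_i hW.
Let lin_word s : linear (word L s) := linear_word linL s.
Let lin_gamma t : linear (gamma t) := linear_coord Hx hW t.
Let lin_eps : linear eps. Proof. by case: He. Qed.
Let gamma_i u : gamma [::] (i u) = u := coord_i Hx hW u.

(** The map [eps] commutes with [x], so [i] composed with [eps] is again a degree zero map and
    extends by the universal property. *)
Lemma theta_exists : exists f : W -> W,
  [/\ linear f, forall n w, f (L n w) = L n (f w) & forall u, f (i u) = i (eps u)].
Proof.
case: (hW) => HL [_ ipos i0] H.
have Hg : degree_zero_map x L (fun u => i (eps u)).
  split=> [|n u n0|u]; first exact: linear_comp.
    exact: ipos.
  by rewrite i0 (linB Hx) (linZ Hx).
by have [f [Hf _]] := H _ _ _ HL Hg; exists f.
Qed.

(* This is the nilpotent part of [L_0], by [theta_L0_space]. *)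
Definition theta : W -> W := projT1 (cid theta_exists).

Lemma linear_theta : linear theta.
Proof. by rewrite /theta; case: cid => f []. Qed.
Let lin_theta := linear_theta.

Lemma theta_L n w : theta (L n w) = L n (theta w).
Proof. by rewrite /theta; case: cid => f []. Qed.

Lemma theta_i u : theta (i u) = i (eps u).
Proof. by rewrite /theta; case: cid => f []. Qed.

Lemma theta_word s w : theta (word L s w) = word L s (theta w).
Proof. exact/word_hom/theta_L. Qed.

Lemma iter_theta_L m n w : iter m theta (L n w) = L n (iter m theta w).
Proof. by elim: m => //= m ->; rewrite theta_L. Qed.

Lemma iter_theta_i m u : iter m theta (i u) = i (iter m eps u).
Proof. by elim: m => //= m ->; rewrite theta_i. Qed.

Lemma coord_theta t w : is_part t -> gamma t (theta w) = eps (gamma t w).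
Proof.
move=> Ht; move: w; apply: (induced_eq Hx hW).
- exact: linear_comp.
- by apply: (linear_comp lin_eps).
move=> s u Hs; rewrite theta_word theta_i !coord_word //.
by case: eqP => // _; rewrite (lin0 Hx) scaler0 subr0.
Qed.

Lemma coord_iter_theta m t w : is_part t ->
  gamma t (iter m theta w) = iter m eps (gamma t w).
Proof. by move=> Ht; elim: m => //= m <-; rewrite coord_theta. Qed.

Lemma iter_theta0 w : iter k theta w = 0.
Proof.
apply: (@coord_inj _ c _ _ Hx _ _ _ hW) => t Ht.
by rewrite coord_iter_theta // (iter_eps0 He).
Qed.

Lemma coord_L0_shift mu t w : is_part t ->
  gamma t (L 0 w - mu *: w) =
    eps (gamma t w) + (h + (sumn t)%:R - mu) *: gamma t w.
Proof.
move=> Ht; rewrite (linB (lin_gamma _)) (linZ (lin_gamma _)) coord_L0 //.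
rewrite !scalerDl scaleNr -!addrA; congr (_ + _).
by rewrite addKr.
Qed.

(** Convertible with [weight_space] when [L] is [vmodL W], but available for bare Virasoro
    modules. *)
Definition L0_space (mu : C) : set W :=
  [set w | exists n, iter n (fun u => L 0 u - mu *: u) w = 0].

(** In the coordinate [t], L_0 - mu is [eps] plus a nonzero scalar, hence injective. *)
Lemma coord_L0_space mu t w : is_part t -> L0_space mu w ->
  h + (sumn t)%:R <> mu -> gamma t w = 0.
Proof.
move=> Ht [n Hn] /eqP; rewrite -subr_eq0 => /eqP Hmu.
apply: (@iter_eps_add_inj _ _ eps k e He n (h + (sumn t)%:R - mu)) => //.
have <- : gamma t (iter n (fun u => L 0 u - mu *: u) w) =
   iter n (fun v => eps v + (h + (sumn t)%:R - mu) *: v) (gamma t w).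
  by elim: (n) => //= m IH; rewrite coord_L0_shift // IH.
by rewrite Hn (lin0 (lin_gamma _)).
Qed.

Lemma degree_theta l w : degree_space L i l w -> degree_space L i l (theta w).
Proof.
move: w; apply: (lspan_min (S := [set w | degree_space L i l (theta w)])).
  by apply: subspace_preimage => //; apply: subspace_lspan.
move=> _ [s [u [Hs Hl ->]]]; apply: sub_lspan; exists s, (eps u); split=> //.
by rewrite -/(word L s _) theta_word theta_i.
Qed.

Lemma L0_degree l w : degree_space L i l w -> L 0 w = (h + l%:R) *: w + theta w.
Proof.
move: w; apply: (lspan_min (S := [set w | L 0 w = (h + l%:R) *: w + theta w])).
  by apply: subspace_eq => //; apply: linear_add => //; apply: linear_scale.
move=> _ [s [u [Hs <- ->]]] /=.
rewrite -/(word L s _) (L0_word hW) theta_word theta_i; case: hW => _ [_ _ ->] _.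
rewrite (linB lini) (linZ lini) (linB (lin_word _)) (linZ (lin_word _)).
by rewrite scalerDl addrC [h *: _ + _]addrC -addrA; congr (_ + _); rewrite subrKC.
Qed.

(** In degree l, L_0 - (h + l) is the nilpotent [theta]. Conversely the coordinates of a generalized
    eigenvector vanish in all other degrees, the numbers h + l being distinct. *)
Lemma degree_L0_space l : degree_space L i l = L0_space (h + l%:R).
Proof.
apply/seteqP; split=> w Hw.
  exists k; suff H n : iter n (fun u => L 0 u - (h + l%:R) *: u) w = iter n theta w /\
    degree_space L i l (iter n theta w) by rewrite (H k).1 iter_theta0.
  elim: n => [//|n [/= -> Hn]]; split; last exact: degree_theta.
  by rewrite (L0_degree Hn) addrC addKr.
have [r [Hr _ ->]] := pbw_decomp Hx hW w.
apply: subspace_sum_seq; first exact: subspace_lspan.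
move=> s sr; have Hs := allP Hr _ sr.
case: (eqVneq (sumn s) l) => [sl|sl].
  apply: sub_lspan; exists s, (gamma s w); split=> //.
  by move: Hs; rewrite /is_part => /andP[].
rewrite (coord_L0_space Hs Hw) ?(lin0 lini) ?(lin0 (lin_word _)).
  exact: (subspace_lspan _).1.
by move/addrI/eqP; rewrite eqr_nat (negbTE sl).
Qed.

Lemma L0_space_trivial mu w : (forall l : nat, mu <> h + l%:R) ->
  L0_space mu w -> w = 0.
Proof.
move=> Hmu Hw; apply: (@coord_inj _ c _ _ Hx _ _ _ hW) => t Ht.
by apply: coord_L0_space Hw _ => // /esym/Hmu.
Qed.

Lemma degree_span w : lspan (\bigcup_l degree_space L i l) w.
Proof.
move: w; apply: (induced_ind Hx hW); first exact: subspace_lspan.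
move=> s u Hs; apply: sub_lspan; exists (sumn s) => //; apply: sub_lspan.
by exists s, u; split=> //; case/andP: Hs.
Qed.

(** The generalized eigenspaces span; hence the graded pseudo-trace does not depend on the chosen
    [L0_nilpotent_part]. *)
Lemma theta_unique (N : W -> W) : linear N ->
  (forall mu w, L0_space mu w -> N w = L 0 w - mu *: w) -> N =1 theta.
Proof.
move=> HN H w; have := degree_span w; move: w; apply: (lspan_min (S := [set w | N w = theta w])).
  exact: subspace_eq.
move=> w [l _ Hl]; rewrite /= (H (h + l%:R)) -?degree_L0_space //.
by rewrite (L0_degree Hl) addrC addKr.
Qed.

Lemma theta_L0_space mu w : L0_space mu w -> theta w = L 0 w - mu *: w.
Proof.
case: (pselect (exists l : nat, mu = h + l%:R)) => [[l ->]|Hmu Hw].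
  by rewrite -degree_L0_space => Hw; rewrite (L0_degree Hw) addrC addKr.
rewrite (L0_space_trivial _ Hw) ?(lin0 lin_theta) ?(lin0 (linL _)) ?scaler0 ?subr0 //.
by move=> l Hl; apply: Hmu; exists l.
Qed.

Definition chain_sub (j : nat) : set W := [set w | iter j theta w = 0].

Lemma subspace_chain_sub j : subspace (chain_sub j).
Proof. exact/subspace_ker/linear_iter. Qed.

Lemma submodule_chain_sub j : submodule L (chain_sub j).
Proof.
split; first exact: subspace_chain_sub.
by move=> n w; rewrite /chain_sub /= iter_theta_L => ->; rewrite (lin0 (linL n)).
Qed.

Lemma chain_sub0 : chain_sub 0 = [set 0].
Proof. by apply/seteqP; split. Qed.

Lemma chain_subT : chain_sub k = setT.
Proof. by apply/seteqP; split=> // w _; apply: iter_theta0. Qed.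

Lemma chain_sub_le j j' : (j <= j')%N -> chain_sub j `<=` chain_sub j'.
Proof.
move=> /subnK <- w; rewrite /chain_sub /= iterD => ->.
exact/lin0/linear_iter.
Qed.

Lemma chain_sub_e j b : (b < k)%N -> chain_sub j (i (e b)) <-> (b < j)%N.
Proof.
move=> bk; rewrite /chain_sub /= iter_theta_i (iter_chain He) //.
case: leqP => jb; last by split=> // _; rewrite (lin0 lini).
split=> // /(congr1 (gamma [::])); rewrite gamma_i (lin0 (lin_gamma _)) => eb.
have := iter_chain He (b - j)%N (_ : b - j < k)%N.
rewrite leqnn subnn eb (lin0 (linear_iter _ lin_eps)) => /(_ (leq_ltn_trans (leq_subr _ _) bk)).
by case: He => _ _ + _ _ => + /esym.
Qed.

Lemma chain_sub_lt j : (j < k)%N -> chain_sub j `<` chain_sub j.+1.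
Proof.
move=> jk; split; first exact: chain_sub_le.
move=> /(_ (i (e j))) H; have := (chain_sub_e j jk).1 (H _).
by rewrite ltnn => /(_ ((chain_sub_e _ jk).2 (ltnSn _))).
Qed.

(** [theta] acts coordinatewise, so each coordinate of an element of the kernel lies in the kernel
    of [eps ^ j], the span of the first [j] chain vectors. *)
Lemma chain_sub_gen j (S : set W) : (j <= k)%N -> submodule L S ->
  (forall b, (b < j)%N -> S (i (e b))) -> chain_sub j `<=` S.
Proof.
move=> jk HS He' w Hw; apply: (submodule_span (Hx := Hx) (hW := hW) HS) => t Ht.
have [a ->] : exists a : nat -> C, gamma t w = \sum_(b < j) a b *: e b.
  by apply: (ker_chain He jk); rewrite -coord_iter_theta // Hw (lin0 (lin_gamma _)).
rewrite (lin_sum lini); apply: subspace_sum => [|b _]; first exact: HS.1.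
by rewrite (linZ lini); apply: subspaceZ; [exact: HS.1|exact: He'].
Qed.

(** The image of [theta ^ (k - j)] is a submodule, and it contains the generators of the kernel
    since [e b] is reached from [e (b + (k - j))]. *)
Lemma chain_sub_image j w : (j <= k)%N -> chain_sub j w ->
  exists w', w = iter (k - j) theta w'.
Proof.
move=> jk; set S := [set w | exists w', w = iter (k - j) theta w'].
have lin_it m := linear_iter m lin_theta.
have HS : submodule L S.
  split; last by move=> n _ [w' ->]; exists (L n w'); rewrite iter_theta_L.
  split; first by exists 0; rewrite (lin0 (lin_it _)).
  by move=> a _ _ [u ->] [v ->]; exists (a *: u + v); rewrite lin_it.
apply: (chain_sub_gen (S := S)) => // b bj; exists (i (e (b + (k - j))%N)).
by rewrite iter_theta_i (iter_chain He) ?leq_addl ?addnK //; lia.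
Qed.

Context {M : lmodType C} (LM : int -> M -> M) (v0 : M).
Hypothesis hM : verma_module c h LM v0.
Hypothesis hT : maximal_proper_submodule LM [set 0].

(* The Verma module is simple and maps onto [chain_sub 1]. *)
Lemma chain_sub1_simple S : submodule L S -> S `<=` chain_sub 1 ->
  S = [set 0] \/ chain_sub 1 `<=` S.
Proof.
move=> HS S1; case: (hW) (hM) => HL [_ ipos i0] _ [_ _ H].
have e0E : x (e 0%N) = h *: e 0%N.
  by case: He => _ _ _ /eqP; rewrite subr_eq0 => /eqP.
have Hg : degree_zero_map (fun a : C^o => (h * a : C^o)) L
    (fun a : C^o => (a : C) *: i (e 0%N)).
  split=> [a u v|n u n0|u]; first by rewrite scalerDl scalerA.
    by rewrite (linZ (linL _)) ipos // scaler0.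
  by rewrite (linZ (linL _)) i0 e0E (linZ lini) scalerA mulrC.
have [f [[Hf fL fv] _]] := H _ _ _ HL Hg.
have {}fv : f v0 = i (e 0%N) by have := fv 1; rewrite !scale1r.
have f_onto : chain_sub 1 `<=` [set w | exists m, w = f m].
  apply: chain_sub_gen => //.
    split; last by move=> n _ [m ->]; exists (LM n m); rewrite fL.
    split; first by exists 0; rewrite (lin0 Hf).
    by move=> a _ _ [m ->] [m' ->]; exists (a *: m + m'); rewrite Hf.
  by move=> [|//] _; exists v0.
have HfS : submodule LM [set m | S (f m)].
  split; first exact: subspace_preimage Hf HS.1.
  by move=> n m /=; rewrite fL; apply: HS.2.
have [_ _ /(_ _ HfS)[|fS0|fST]] := hT.
- by move=> _ ->; rewrite /= (lin0 Hf); exact: HS.1.1.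
- left; apply/seteqP; split=> [w Sw|_ ->]; last exact: HS.1.1.
  have [m Em] := f_onto _ (S1 _ Sw); have : [set m | S (f m)] m by rewrite /= -Em.
  by rewrite fS0 Em => ->; rewrite (lin0 Hf).
right; apply: chain_sub_gen => // -[|//] _.
by rewrite -fv; have : [set m | S (f m)] v0 by rewrite fST.
Qed.

(* A polynomial in [L_0] that annihilates the components of the degrees of
   the [t] in [r] and is invertible on the other components. *)
Definition L0_kill (r : seq (seq nat)) (w : W) : W :=
  foldr (fun t => iter k (fun v => L 0 v - (h + (sumn t)%:R) *: v)) w r.

(* If [theta ^ j] maps [S] onto [chain_sub 1], some [s] in [S] is sent to
   [i (e 0)]. Its degree zero component, up to an invertible operator, is a
   vector [i u'] of [S] with [u'] of height [j + 1]; the Jordan chain of [u']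
   generates [chain_sub j.+1]. *)
Lemma submodule_class S : submodule L S ->
  exists2 j, (j <= k)%N & S = chain_sub j.
Proof.
move=> HS.
have Hex : exists j, `[< S `<=` chain_sub j >].
  by exists k; apply/asboolP; rewrite chain_subT.
case: (ex_minnP Hex) => j /asboolP Sj jmin; exists j.
  by apply: jmin; apply/asboolP; rewrite chain_subT.
apply/seteqP; split=> //.
have jk : (j <= k)%N by apply: jmin; apply/asboolP; rewrite chain_subT.
case: j => [|j] in Sj jmin jk *; first by rewrite chain_sub0 => _ ->; exact: HS.1.1.
have lin_it m := linear_iter m lin_theta.
(* By minimality the image of [S] under [theta ^ j] is nonzero; as a submodule of the simple
   [chain_sub 1] it is everything. *)
have [s Ss sj] : exists2 s, S s & iter j theta s = i (e 0%N).
  have HS' : submodule L [set w | exists2 s, S s & iter j theta s = w].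
    split; last first.
      by move=> n _ [s Ss <-]; exists (L n s); rewrite ?iter_theta_L //; apply: HS.2.
    split; first by exists 0; [exact: HS.1.1|rewrite (lin0 (lin_it _))].
    move=> a _ _ [u Su <-] [v Sv <-]; exists (a *: u + v); last by rewrite lin_it.
    exact: HS.1.2.
  case: (chain_sub1_simple HS').
  - by move=> _ [s Ss <-]; rewrite /chain_sub /= -iterS; apply: Sj.
  - move=> S0; suff : (j.+1 <= j)%N by rewrite ltnn.
    apply: jmin; apply/asboolP => s Ss.
    suff : [set 0 : W] (iter j theta s) by [].
    by rewrite -S0; exists s.
  by apply; apply/chain_sub_e.
have [r [Hr Ur Es]] := pbw_decomp Hx hW s.
pose r0 := [seq t <- r | t != [::]]; pose z := L0_kill r0 s.
have Sz : S z.
  rewrite /z; elim: (r0) => //= t q IH; elim: (k) => //= m IHm.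
  apply: subspaceB; [exact: HS.1|exact: HS.2|].
  by apply: subspaceZ; first exact: HS.1.
(* The effect of [L0_kill q] on the coordinate [t]: a factor with t' = t is [eps ^ k] and kills
   it. *)
pose step (q : seq (seq nat)) (t : seq nat) v := foldr (fun t' : seq nat =>
  iter k (fun v => eps v + (h + (sumn t)%:R - (h + (sumn t')%:R)) *: v)) v q.
have coord_kill q t w : is_part t -> gamma t (L0_kill q w) = step q t (gamma t w).
  move=> Ht; elim: q => //= t' q <-; elim: (k) => //= m <-.
  by rewrite coord_L0_shift.
have lin_st a : linear (fun v => eps v + a *: v).
  by apply: linear_add => //; apply: linear_scale; apply: linear_id.
have step0 q t : step q t 0 = 0.
  by elim: q => //= t' q ->; apply/lin0/linear_iter.
have zE : z = i (gamma [::] z).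
  apply/eqP; rewrite -subr_eq0; apply/eqP.
  apply: (@coord_inj _ c _ _ Hx _ _ _ hW) => t Ht.
  rewrite (linB (lin_gamma _)) (@coord_word _ c _ _ Hx _ _ _ hW [::]) //.
  case: eqP => [<-|/eqP tN]; first by rewrite subrr.
  rewrite subr0 /z coord_kill //; case: (boolP (t \in r)) => tr; last first.
    suff -> : gamma t s = 0 by apply: step0.
    rewrite Es (lin_sum (lin_gamma _)) big_seq big1 // => t' tr'.
    rewrite coord_word ?(allP Hr _ tr') //; case: eqP => // tt'.
    by rewrite -tt' tr' in tr.
  have : t \in r0 by rewrite mem_filter tr eq_sym tN.
  elim: (r0) => //= t' q IH; rewrite inE => /predU1P[<-|/IH ->].
    rewrite subrr (_ : iter k _ _ = iter k eps (step q t (gamma t s))).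
      exact: (iter_eps0 He).
    by apply: eq_iter => v; rewrite scale0r addr0.
  by apply/lin0/linear_iter.
set u' := gamma [::] z in zE.
(* The eigenvalue of [L0_kill r0] on [i (e 0)]. It is nonzero since [r0] omits the empty partition,
   so the projection keeps the height of [s]. *)
pose d := \prod_(t <- r0) (h - (h + (sumn t)%:R)) ^+ k.
have theta_z : iter j theta z = d *: i (e 0%N).
  rewrite /z /d; have -> q w : iter j theta (L0_kill q w) = L0_kill q (iter j theta w).
    elim: q => //= t q <-; elim: (k) => //= m IHm.
    by rewrite (linB (lin_it _)) (linZ (lin_it _)) iter_theta_L IHm.
  have kill_e m mu b : iter m (fun v => L 0 v - mu *: v) (b *: i (e 0%N)) =
      ((h - mu) ^+ m * b) *: i (e 0%N).
    have e0E : x (e 0%N) = h *: e 0%N.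
      by case: He => _ _ _ /eqP; rewrite subr_eq0 => /eqP.
    elim: m => [|m IHm] /=; first by rewrite mul1r.
    rewrite IHm (linZ (linL _)); case: (hW) => _ [_ _ ->] _.
    by rewrite e0E (linZ lini) !scalerA -scalerBl exprS; congr (_ *: _); ring.
  rewrite sj; elim: (r0) => [|t q IH] /=; first by rewrite big_nil scale1r.
  by rewrite big_cons IH kill_e.
have d0 : d != 0.
  rewrite /d prodf_seq_neq0; apply/allP => t; rewrite mem_filter => /andP[tN tr].
  apply/implyP => _; rewrite expf_neq0 // opprD addrA subrr add0r oppr_eq0 pnatr_eq0.
  have := allP Hr _ tr; case: t tN {tr} => // m t _; rewrite is_part_cons /=.
  by case/andP => m0 _; rewrite addn_eq0 negb_and -lt0n m0.
have u'j : iter j eps u' = d *: e 0%N.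
  by rewrite -[LHS]gamma_i -iter_theta_i -zE theta_z -(linZ lini) gamma_i.
have u'j1 : iter j.+1 eps u' = 0.
  by rewrite iterS u'j (linZ lin_eps); case: He => _ _ _ -> _; rewrite scaler0.
have [a Ea] := ker_chain He jk u'j1.
have aj : a j <> 0.
  move: u'j; rewrite Ea (iter_chain_top He) // => /eqP.
  rewrite -subr_eq0 -scalerBl => /eqP/(chain_scale0 He)/eqP; rewrite subr_eq0 => /eqP ->.
  exact/eqP.
(* On degree zero [eps] is L_0 - h, which preserves [S]. *)
have Seps m : S (i (iter m eps u')).
  elim: m => [|m IH] /=; first by rewrite -zE.
  rewrite (linB lini) (linZ lini); case: (hW) => _ [_ _ <-] _.
  apply: subspaceB; [exact: HS.1|exact: HS.2|].
  by apply: subspaceZ => //; exact: HS.1.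
apply: chain_sub_gen => // b; elim/ltn_ind: b => b IH bj.
have := Seps (j - b)%N.
(* The top term is [a j *: e b] with [a j <> 0]; the lower terms are in [S] by induction on [b]. *)
have -> : iter (j - b) eps u' = \sum_(m < b.+1) a (m + (j - b))%N *: e m.
  rewrite Ea (lin_sum (linear_iter _ lin_eps)) -(big_mkord xpredT
    (fun m => iter (j - b) eps (a m *: e m))).
  rewrite (big_cat_nat (n := (j - b)%N)) //=; last by lia.
  rewrite big_nat big1 => [|m /andP[_ mj]]; last first.
    rewrite (linZ (linear_iter _ lin_eps)) (iter_chain He); last by lia.
    by rewrite ifF ?scaler0 //; lia.
  rewrite add0r -{1}[(j - b)%N]add0n big_addn.
  have -> : (j.+1 - (j - b) = b.+1)%N by lia.
  rewrite big_mkord; apply: eq_bigr => m _; have := ltn_ord m => mb.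
  rewrite (linZ (linear_iter _ lin_eps)) (iter_chain He); last by lia.
  by rewrite leq_addl addnK.
rewrite big_ord_recr /= (linD lini) (lin_sum lini) subnKC // => HSb.
have Slow : S (\sum_(m < b) i (a (m + (j - b))%N *: e m)).
  apply: subspace_sum => [|m _]; first exact: HS.1.
  rewrite (linZ lini); apply: subspaceZ; first exact: HS.1.
  by apply: IH; [exact: ltn_ord|apply: ltn_trans (ltn_ord m) bj].
have := subspaceB HS.1 HSb Slow; rewrite addrC addKr (linZ lini).
move/(subspaceZ (a j)^-1 HS.1); rewrite scalerA mulVf ?scale1r //.
exact/eqP.
Qed.
End Uniserial.

(** * Modes of the universal Virasoro vertex operator algebra *)

Lemma int_binomial_nat (C : fieldType) (m i : nat) :
  (m < i)%N -> int_binomial C m%:Z i = 0.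
Proof.
by move=> mi; rewrite /int_binomial (bigD1 (Ordinal mi)) //= subrr !mul0r.
Qed.

Lemma int_binomial_0 (C : fieldType) (p : int) : int_binomial C p 0%N = 1.
Proof. by rewrite /int_binomial big_ord0 /= invr1 mulr1. Qed.

Lemma int_binomial_1 (C : fieldType) (p : int) : int_binomial C p 1%N = p%:~R.
Proof. by rewrite /int_binomial big_ord1 /= invr1 mulr1 subr0. Qed.

Section Modes.
Context {C : fieldType} {V : voa C} (W : vmodule V).

(** The Jacobi identity at p = 0, where only the term i = 0 survives on the left. It expresses the
    modes of u_r v by those of u and v. *)
Lemma iterate_formula (u v : V) (r q : int) (w : W) :
  exists N : nat, forall n, (N <= n)%N ->
    vmodY (voaY u r v) q w =
    \sum_(i < n) ((-1) ^+ i * int_binomial C r i) *: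
       (vmodY u (r - i%:Z) (vmodY v (q + i%:Z) w)
        - ((-1) ^ r) *: vmodY v (q + r - i%:Z) (vmodY u i%:Z w)).
Proof.
have [N HN] := @vmod_jacobi _ _ W u v 0 q r w.
exists N.+1 => n Nn; have := HN n (ltnW Nn).
case: n Nn => // n _; rewrite big_ord_recl /= big1 => [|i _]; last first.
  by rewrite (int_binomial_nat _ (m := 0)) ?scale0r.
rewrite int_binomial_0 scale1r addr0 add0r subr0 !addr0 => ->.
by apply: eq_bigr => i _; rewrite !add0r.
Qed.

(** The Jacobi identity for omega and v at p = 1, r = 0. On the left only omega_0 v = L_{-1} v and
    omega_1 v = L_0 v contribute. *)
Lemma commutator_L0 (v : V) (m n : int) (w : W) : voaL 0 v = m%:~R *: v ->
  vmodL W 0 (vmodY v n w) = vmodY v n (vmodL W 0 w) + (m - n - 1)%:~R *: vmodY v n w.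
Proof.
move=> Hv; have [N HN] := @vmod_jacobi _ _ W (voa_omega V) v 1 n 0 w.
have := HN N.+2 (leq_trans (leqnSn _) (leqnSn _)).
rewrite !big_ord_recl [\sum_(i < N) _]big1 => [|i _]; last first.
  by rewrite (int_binomial_nat _ (m := 1)) ?scale0r.
rewrite big1 => [|i _]; last first.
  by rewrite (int_binomial_nat _ (m := 0)) ?mulr0 ?scale0r.
have -> : fintype.lift ord0 ord0 = 1%N :> nat by [].
have -> : (ord0 : 'I_N.+2) = 0%N :> nat by [].
rewrite (int_binomial_nat _ (m := 0) (i := 1)) // mulr0 scale0r !int_binomial_0.
rewrite -[0%N%:Z]/(0 : int) -[1%N%:Z]/(1 : int) int_binomial_1 expr0 !mul1r !scale1r !addr0 ?subr0 ?expr0z ?scale1r !add0r.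
rewrite -[voaY (voa_omega V) 0 v]/(voaL (-1) v) (vmod_derivative v).
have -> : voaY (voa_omega V) 1 v = m%:~R *: v by rewrite -Hv.
have -> : 1 + n - 1 = n by ring.
rewrite (linZ (fun a u u' => @vmod_linear_l _ _ W n w a u u')).
rewrite -scalerDl => /eqP; rewrite eq_sym subr_eq => /eqP; rewrite /vmodL add0r => ->.
by rewrite addrC; congr (_ + _ *: _); rewrite -rmorphN -rmorphD; congr (_%:~R); ring.
Qed.

Context (c : C) (hV : is_universal_virasoro_voa c V).

(** [V] is a quotient of a Verma module, hence spanned by words in the L_n applied to the vacuum. *)
Lemma universal_voa_ind (P : set V) : subspace P -> P (voa_vac V) ->
  (forall n v, P v -> P (voaL n v)) -> forall v, P v.
Proof.
move=> HP Pvac PL v; have [_ _ [M [L [v0 [f [hM [Hf fL] fv0 fT _]]]]]] := hV.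
have Hx : linear (fun a : C^o => (0 * a : C^o)).
  by move=> a u u'; rewrite !mul0r scaler0 addr0.
have [m _ <-] : range f v by rewrite fT.
move: m; apply: (induced_ind Hx hM); first exact: subspace_preimage.
move=> s a _ /=; rewrite (word_hom _ _ fL) (linZ Hf) fv0.
by elim: s => [|n s IH] /=; [apply: subspaceZ|apply: PL].
Qed.

(** L_n v is omega_{n+1} v, so [iterate_formula] builds its modes from those of omega and of v, and
    stability passes from v to L_n v. *)
Lemma submodule_modes (S : set W) :
  submodule (modes W) S <-> submodule (vmodL W) S.
Proof.
split=> -[HS SL]; split=> //; first by move=> n w; apply: (SL (voa_omega V, n + 1)).
move=> [v n] w Sw; rewrite /modes /=; move: v n w Sw.
apply: (universal_voa_ind (P := [set v | forall n w, S w -> S (vmodY v n w)])).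
- split=> [n w Sw|a u v Hu Hv n w Sw].
    by rewrite (lin0 (fun a u u' => @vmod_linear_l _ _ W n w a u u')); exact: HS.1.
  by rewrite vmod_linear_l; apply: HS.2; [apply: Hu|apply: Hv].
- by move=> n w Sw; rewrite vmod_vacuum; case: ifP => // _; exact: HS.1.
move=> n v Hv q w Sw; have [N HN] := iterate_formula (voa_omega V) v (n + 1) q w.
have SO p w' : S w' -> S (vmodY (voa_omega V) p w').
  by move=> Sw'; rewrite -(subrK 1 p); apply: SL.
rewrite (HN _ (leqnn _)); apply: subspace_sum => // i _; apply: subspaceZ => //.
apply: subspaceB => //; first by apply/SO/Hv.
by apply: subspaceZ => //; apply/Hv/SO.
Qed.

Lemma endomorphism_modes (f : W -> W) :
  module_endomorphism (modes W) f <->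
  linear f /\ forall n w, f (vmodL W n w) = vmodL W n (f w).
Proof.
split=> -[Hf fL]; split=> //; first by move=> n w; apply: (fL (voa_omega V, n + 1)).
move=> [v n] w; rewrite /modes /=; move: v n w.
have fO p w : f (vmodY (voa_omega V) p w) = vmodY (voa_omega V) p (f w).
  by rewrite -(subrK 1 p); apply: fL.
apply: (universal_voa_ind (P := [set v | forall n w, f (vmodY v n w) = vmodY v n (f w)])).
- split=> [n w|a u v Hu Hv n w].
    have H0 w' := lin0 (fun a u u' => @vmod_linear_l _ _ W n w' a u u').
    by rewrite !H0 (lin0 Hf).
  by rewrite !vmod_linear_l Hf Hu Hv.
- by move=> n w; rewrite !vmod_vacuum; case: ifP => // _; rewrite (lin0 Hf).
move=> n v Hv q w; have [N HN] := iterate_formula (voa_omega V) v (n + 1) q w.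
have [N' HN'] := iterate_formula (voa_omega V) v (n + 1) q (f w).
rewrite (HN _ (leq_maxl N N')) (HN' _ (leq_maxr N N')) (lin_sum Hf).
by apply: eq_bigr => i _; rewrite (linZ Hf) (linB Hf) (linZ Hf) fO !Hv fO.
Qed.

Lemma mode_weight_space (v : V) (m : int) mu (w : W) : voaL 0 v = m%:~R *: v ->
  weight_space W mu w -> weight_space W mu (vmodY v (m - 1) w).
Proof.
move=> Hv [n Hn]; exists n.
have E w' : vmodL W 0 (vmodY v (m - 1) w') - mu *: vmodY v (m - 1) w' =
    vmodY v (m - 1) (vmodL W 0 w' - mu *: w').
  rewrite (commutator_L0 _ _ Hv) (_ : m - (m - 1) - 1 = 0); last by ring.
  have Hr := @vmod_linear_r _ _ W v (m - 1).
  by rewrite scale0r addr0 (linB Hr) (linZ Hr).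
have -> : iter n (fun u : W => vmodL W 0 u - mu *: u) (vmodY v (m - 1) w) =
  vmodY v (m - 1) (iter n (fun u : W => vmodL W 0 u - mu *: u) w).
  by elim: (n) => //= q ->; rewrite E.
by rewrite Hn (lin0 (@vmod_linear_r _ _ W v (m - 1))).
Qed.

Lemma subspace_weight_space mu : subspace (weight_space W mu).
Proof.
set g := fun u : W => vmodL W 0 u - mu *: u.
have Hg : linear g.
  apply: linear_sub; first exact: vmod_linear_r.
  by apply: linear_scale; apply: linear_id.
split; first by exists 0%N.
move=> a u v [m Hm] [n Hn]; exists (m + n)%N; rewrite (linear_iter _ Hg).
rewrite {1}addnC !iterD Hm Hn !(lin0 (linear_iter _ Hg)) scaler0 addr0 //.
Qed.

Lemma weight_preserving_zero_mode v : weight_preserving_operator (zero_mode (W := W) v).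
Proof.
rewrite /zero_mode; case: cid => s [Hs _] /=; split.
- by apply: linear_sumf => p; apply: vmod_linear_r.
- move=> mu w Hw; apply: subspace_sum_seq; first exact: subspace_weight_space.
  by move=> p /Hs Hp; apply: mode_weight_space.
elim: s Hs => [|p s IH] Hs.
  (* The zero operator has no constructor of its own in [generated_algebra]; it is written as - id +
     id. *)
  have -> : (fun w : W => \sum_(p <- [::]) vmodY p.2 (p.1 - 1) w) =
      (fun w => (-1) *: id w + id w).
    by apply/funext => w; rewrite big_nil scaleN1r addNr.
  by apply: GenAlgLin; apply: GenAlgOne.
have -> : (fun w : W => \sum_(p <- p :: s) vmodY p.2 (p.1 - 1) w) =
    (fun w => 1 *: vmodY p.2 (p.1 - 1) w + \sum_(p <- s) vmodY p.2 (p.1 - 1) w).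
  by apply/funext => w; rewrite big_cons scale1r.
apply: GenAlgLin; first by apply: GenAlgBase; left; exists (p.2, p.1 - 1).
by apply: IH => q qs; apply: Hs; rewrite inE qs orbT.
Qed.
End Modes.

(** * Pseudo-traces as traces over truncated polynomials *)

Section PolyAction.
Context {C : fieldType} {W : lmodType C} (theta : W -> W) (lin_theta : linear theta).
Let lin_iter m : linear (iter m theta) := linear_iter m lin_theta.
Implicit Types (p q : {poly C}) (w : W).

(** The operator p(theta). Polynomials, compared by [congXn], represent elements of C[t]/(t^k), and
    no quotient ring has to be formed. *)
Definition pact p w : W := \sum_(m < size p) p`_m *: iter m theta w.

Lemma pactE n p w : (size p <= n)%N ->
  pact p w = \sum_(m < n) p`_m *: iter m theta w.
Proof.
move=> Hn; rewrite /pact (big_ord_widen n (fun m => p`_m *: iter m theta w)) //.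
rewrite big_mkcond; apply: eq_bigr => m _; case: ifP => // Hm.
by rewrite nth_default ?scale0r // leqNgt Hm.
Qed.

Lemma pact_trunc k p w : iter k theta w = 0 ->
  pact p w = \sum_(m < k) p`_m *: iter m theta w.
Proof.
move=> Hk; rewrite (@pactE (maxn k (size p))) ?leq_maxr //.
rewrite [RHS](big_ord_widen (maxn k (size p)) (fun m => p`_m *: iter m theta w)) ?leq_maxl //.
rewrite [RHS]big_mkcond; apply: eq_bigr => m _; case: ifP => // /negbT.
by rewrite -leqNgt => /subnK <-; rewrite iterD Hk (lin0 (lin_iter _)) scaler0.
Qed.

Lemma linear_pact p : linear (pact p).
Proof. by apply: linear_sumf => m; apply: linear_scale. Qed.

Lemma pactD p q w : pact (p + q) w = pact p w + pact q w.
Proof.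
set n := maxn (size p) (size q).
rewrite (@pactE n) ?size_polyD // (@pactE n p) ?leq_maxl // (@pactE n q) ?leq_maxr //.
by rewrite -big_split; apply: eq_bigr => m _; rewrite coefD scalerDl.
Qed.

Lemma pactC a w : pact a%:P w = a *: w.
Proof. by rewrite (@pactE 1) ?size_polyC_leq1 // big_ord1 coefC. Qed.

Lemma pact0 w : pact 0 w = 0.
Proof. by rewrite -[0]/(0%:P) pactC scale0r. Qed.

Lemma pact_sum I (r : seq I) (F : I -> {poly C}) w :
  pact (\sum_(s <- r) F s) w = \sum_(s <- r) pact (F s) w.
Proof. by elim/big_rec2: _ => [|s q p _ <-]; rewrite ?pact0 ?pactD. Qed.

Lemma pactZ a p w : pact (a *: p) w = a *: pact p w.
Proof.
rewrite (@pactE (size p)) ?size_scale_leq // scaler_sumr.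
by apply: eq_bigr => m _; rewrite coefZ scalerA.
Qed.

Lemma pactMX p w : pact (p * 'X) w = theta (pact p w).
Proof.
rewrite (@pactE (size p).+1); last first.
  by apply: leq_trans (size_polyMleq _ _) _; rewrite size_polyX addn2.
rewrite big_ord_recl coefMX /= scale0r add0r (lin_sum lin_theta).
by apply: eq_bigr => m _; rewrite coefMX (linZ lin_theta).
Qed.

Lemma pactM p q w : pact (p * q) w = pact p (pact q w).
Proof.
elim/poly_ind: p => [|p a IH]; first by rewrite mul0r !pact0.
by rewrite mulrDl !pactD mulrAC !pactMX IH pactC mul_polyC pactZ.
Qed.

Lemma pact_comm (sigma : W -> W) p w : linear sigma ->
  (forall w, sigma (theta w) = theta (sigma w)) -> sigma (pact p w) = pact p (sigma w).
Proof.
move=> Hs Hc; rewrite (lin_sum Hs); apply: eq_bigr => m _; rewrite (linZ Hs).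
by congr (_ *: _); elim: (nat_of_ord m) => //= n <-.
Qed.
End PolyAction.

Definition congXn (C : fieldType) (k : nat) (p q : {poly C}) : Prop :=
  forall m, (m < k)%N -> p`_m = q`_m.

Lemma congXn_mul (C : fieldType) k (p q q' : {poly C}) :
  congXn k q q' -> congXn k (p * q) (p * q').
Proof.
move=> H m mk; rewrite !coefM; apply: eq_bigr => j _; congr (_ * _); apply: H.
exact: leq_ltn_trans (leq_subr _ _) mk.
Qed.

Lemma congXn_sum (C : fieldType) k I (r : seq I) (F G : I -> {poly C}) :
  (forall s, congXn k (F s) (G s)) ->
  congXn k (\sum_(s <- r) F s) (\sum_(s <- r) G s).
Proof. by move=> H m mk; rewrite !coef_sum; apply: eq_bigr => s _; apply: H. Qed.

Section JordanBlocks.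
Context {C : fieldType} {W : lmodType C} (theta : W -> W) (lin_theta : linear theta).
Context (K : nat) (S : set W).
Notation pact := (pact theta).

(** There are [K.+1] blocks. The last one, [b K], generates the others under [theta] and is the
    basis over truncated polynomials. *)
Definition jordan_blocks (d : nat) (b : nat -> 'I_d -> W) : Prop :=
  is_basis S (fun p : 'I_K.+1 * 'I_d => b p.1 p.2) /\
  forall s, theta (b 0%N s) = 0 /\
    forall j, (j < K)%N -> theta (b j.+1 s) = b j s.

Section OneBasis.
Context (d : nat) (b : nat -> 'I_d -> W) (Hb : jordan_blocks b).

Lemma blocks_in (j : nat) s : (j <= K)%N -> S (b j s).
Proof.
move=> jK; apply/(Hb.1.1 _); have jK' : (j < K.+1)%N by [].
exists (fun p => (p == (Ordinal jK', s))%:R).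
rewrite (bigD1 (Ordinal jK', s)) //= eqxx scale1r big1 ?addr0 // => p /negbTE ->.
by rewrite scale0r.
Qed.

Lemma iter_blocks m j s : (m <= j <= K)%N -> iter m theta (b j s) = b (j - m)%N s.
Proof.
elim: m => [|m IH] Hm; first by rewrite subn0.
rewrite /= IH; last by lia.
by rewrite -(subnSK (n := j) (m := m)) ?(Hb.2 s).2 //; lia.
Qed.

Lemma iter_blocks0 j s : (j <= K)%N -> iter K.+1 theta (b j s) = 0.
Proof.
move=> jK; have -> : (K.+1 = (K - j) + j.+1)%N by lia.
rewrite iterD iterS iter_blocks ?leqnn // subnn (Hb.2 s).1.
exact/lin0/linear_iter.
Qed.

Lemma pact_block p s :
  pact p (b K s) = \sum_(m < K.+1) p`_m *: b (K - m)%N s.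
Proof.
rewrite (pact_trunc lin_theta p (iter_blocks0 s (leqnn K))).
by apply: eq_bigr => m _; rewrite iter_blocks // leqnn andbT -ltnS.
Qed.

(** The dictionary between the two kinds of coordinates: the coefficient of t^m belongs to the block
    [K - m], as [b j] is [theta ^ (K - j)] of [b K]. *)
Lemma sum_pact_blocks (p : 'I_d -> {poly C}) :
  \sum_s pact (p s) (b K s) =
    \sum_(q : 'I_K.+1 * 'I_d) (p q.2)`_(K - q.1) *: b q.1 q.2.
Proof.
rewrite (eq_bigr _ (fun s _ => pact_block (p s) s)) exchange_big /=.
rewrite (reindex_inj rev_ord_inj) /= pair_big /=; apply: eq_bigr => -[m s] _ /=.
by rewrite subSS subKn // -ltnS.
Qed.

Lemma blocks_span w : S w -> exists p : 'I_d -> {poly C},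
  w = \sum_s pact (p s) (b K s).
Proof.
case/(Hb.1.1 w) => a ->.
exists (fun s => \poly_(m < K.+1) a (inord (K - m), s)).
rewrite sum_pact_blocks; apply: eq_bigr => -[m s] _ /=; congr (_ *: _).
have mK : (m <= K)%N by rewrite -ltnS.
rewrite coef_poly ltnS leq_subr subKn //; congr (a (_, _)).
by apply/val_inj; rewrite /= inordK.
Qed.

Lemma blocks_free (p : 'I_d -> {poly C}) : \sum_s pact (p s) (b K s) = 0 ->
  forall s, congXn K.+1 (p s) 0.
Proof.
rewrite sum_pact_blocks => /(Hb.1.2 _) H s m mK; rewrite coef0.
have := H (inord (K - m), s); rewrite /= inordK ?ltnS ?leq_subr // subKn //.
Qed.

Lemma blocks_matrix d' (v : 'I_d' -> W) : (forall s, S (v s)) ->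
  exists P : 'M[{poly C}]_(d, d'), forall s, v s = \sum_r pact (P r s) (b K r).
Proof.
move=> Hv; have /choice[p Hp] := fun s => blocks_span (Hv s).
by exists (\matrix_(r, s) p s r) => s; rewrite Hp; apply: eq_bigr => r _; rewrite mxE.
Qed.

Lemma blocks_matrix_cong d' (P Q : 'M[{poly C}]_(d, d')) :
  (forall s, \sum_r pact (P r s) (b K r) = \sum_r pact (Q r s) (b K r)) ->
  forall r s, congXn K.+1 (P r s) (Q r s).
Proof.
move=> H r s m mK; have : \sum_r pact ((P - Q) r s) (b K r) = 0.
  rewrite -[RHS](subrr (\sum_r pact (P r s) (b K r))) [in X in _ = _ - X]H -sumrB.
  apply: eq_bigr => t _; rewrite !mxE pactD; congr (_ + _).
  by rewrite -scaleN1r pactZ scaleN1r.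
move/(blocks_free (p := fun r => (P - Q) r s)) => /(_ r m mK).
by rewrite !mxE coefB coef0 => /eqP; rewrite subr_eq0 => /eqP.
Qed.
End OneBasis.

Lemma pact_mulmx d d' d'' (P : 'M[{poly C}]_(d, d')) (Q : 'M[{poly C}]_(d', d''))
    (v : 'I_d -> W) s :
  \sum_r pact (Q r s) (\sum_q pact (P q r) (v q)) =
  \sum_q pact ((P *m Q) q s) (v q).
Proof.
under eq_bigr => r _ do rewrite (lin_sum (linear_pact lin_theta _)).
rewrite exchange_big /=; apply: eq_bigr => q _; rewrite !mxE pact_sum.
by apply: eq_bigr => r _; rewrite -pactM // mulrC.
Qed.

(* [S] is free over [C[theta]/(theta ^ K.+1)] with basis the last block, and
   [sigma] is linear over this ring; its trace there does not depend on the
   basis. *)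
Lemma trace_blocks (sigma : W -> W) d d' (b : nat -> 'I_d -> W) (b' : nat -> 'I_d' -> W)
    (X : 'M[{poly C}]_d) (X' : 'M[{poly C}]_d') :
  linear sigma -> (forall w, sigma (theta w) = theta (sigma w)) ->
  jordan_blocks b -> jordan_blocks b' ->
  (forall s, sigma (b K s) = \sum_r pact (X r s) (b K r)) ->
  (forall s, sigma (b' K s) = \sum_r pact (X' r s) (b' K r)) ->
  congXn K.+1 (\tr X) (\tr X').
Proof.
move=> Hs Hc Hb Hb' HX HX'.
have [P HP] := blocks_matrix Hb (fun s => blocks_in Hb' s (leqnn K)).
have [Q HQ] := blocks_matrix Hb' (fun s => blocks_in Hb s (leqnn K)).
have X'E : forall r s, congXn K.+1 (X' r s) ((Q *m (X *m P)) r s).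
  apply: (blocks_matrix_cong Hb') => s; rewrite -HX' HP (lin_sum Hs).
  under eq_bigr => r _ do rewrite (pact_comm _ _ Hs Hc) HX.
  rewrite pact_mulmx (eq_bigr _ (fun q _ => congr1 _ (HQ q))).
  by rewrite pact_mulmx.
have PQ1 : forall r s, congXn K.+1 ((P *m Q) r s) ((1%:M : 'M_d) r s).
  apply: (blocks_matrix_cong Hb) => s; rewrite -pact_mulmx.
  under eq_bigr => r _ do rewrite -HP.
  rewrite -HQ (bigD1 s) //= mxE eqxx pactC scale1r big1 ?addr0 // => r /negbTE rs.
  by rewrite mxE rs pact0.
(* With X' congruent to QXP and PQ to 1, the trace of X' is congruent to that of XPQ, hence to that
   of X. Cyclicity holds for rectangular P and Q, so d = d' is not presupposed. *)
move=> m mK; have -> : (\tr X')`_m = (\tr (Q *m (X *m P)))`_m.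
  by apply: congXn_sum mK => r; apply: X'E.
have -> : (\tr X)`_m = (\tr (X *m 1%:M))`_m by rewrite mulmx1.
rewrite [in RHS]mxtrace_mulC -mulmxA.
apply: congXn_sum mK => r n nK; rewrite !mxE.
by apply: congXn_sum nK => q; apply: congXn_mul => l lK; rewrite PQ1.
Qed.
End JordanBlocks.

(** * Bases of the homogeneous subspaces *)

Section Partitions.
Local Open Scope nat_scope.

Definition part_of_mults l (m : {ffun 'I_l -> 'I_l.+1}) : seq nat :=
  sort geq (flatten [seq nseq (m j) j.+1 | j <- enum 'I_l]).

Lemma count_part_of_mults l m (j : 'I_l) :
  count_mem j.+1 (part_of_mults m) = m j :> nat.
Proof.
rewrite count_sort count_flatten -map_comp sumnE big_map big_enum /=.
rewrite (bigD1 j) //= count_nseq /= eqxx mul1n big1 ?addn0 // => j'.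
rewrite -val_eqE /= => /negbTE jj'; by rewrite count_nseq /= eqSS jj'.
Qed.

Lemma sumn_part_of_mults l (m : {ffun 'I_l -> 'I_l.+1}) :
  sumn (part_of_mults m) = \sum_(j < l) j.+1 * m j.
Proof.
rewrite (perm_sumn (s2 := flatten [seq nseq (m j) j.+1 | j <- enum 'I_l])); last first.
  by rewrite perm_sort.
rewrite sumn_flatten -map_comp sumnE big_map big_enum /=.
by apply: eq_bigr => j _; rewrite sumn_nseq.
Qed.

Lemma geq_trans : transitive geq.
Proof. by move=> y x z /= Hxy Hyz; apply: leq_trans Hyz Hxy. Qed.

Lemma is_part_part_of_mults l (m : {ffun 'I_l -> 'I_l.+1}) : is_part (part_of_mults m).
Proof.
apply/andP; split; first by apply: sort_sorted => a b /=; apply: leq_total.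
rewrite all_sort; apply/allP => a /flattenP[t /mapP[j _ ->]].
by rewrite mem_nseq => /andP[_ /eqP ->].
Qed.

Lemma mem_leq_sumn a s : a \in s -> a <= sumn s.
Proof.
elim: s => //= b s IH; rewrite inE => /predU1P[->|/IH Ha]; first exact: leq_addr.
exact: leq_trans Ha (leq_addl _ _).
Qed.

(** All parts are positive with sum l, so parts and multiplicities are at most l and fit the finite
    types. Two sorted lists with equal counts coincide. *)
Lemma part_of_mults_counts l s : is_part s -> sumn s = l ->
  exists2 m : {ffun 'I_l -> 'I_l.+1}, \sum_(j < l) j.+1 * m j = l & part_of_mults m = s.
Proof.
move=> /andP[sorted_s s1] sl.
have le_l : all (geq l) s by apply/allP => a /mem_leq_sumn; rewrite sl.
have count_le j : count_mem j.+1 s <= l.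
  case: (posnP (count_mem j.+1 s)) => [->//|]; rewrite -has_count has_pred1 => js.
  apply: leq_trans (count_size _ _) _; rewrite -sl.
  by elim: (s) s1 => //= a t IH /andP[a1 /IH Ht]; apply: (leq_add a1 Ht).
pose m := [ffun j : 'I_l => (inord (count_mem j.+1 s) : 'I_l.+1)].
have mE j : m j = count_mem j.+1 s :> nat by rewrite ffunE inordK ?ltnS.
have Pm : part_of_mults m = s.
  have anti : antisymmetric geq by move=> a b; rewrite andbC; apply: anti_leq.
  have sorted_m : sorted geq (part_of_mults m).
    by case/andP: (is_part_part_of_mults m).
  apply: (sorted_eq geq_trans anti) => //.
  have count0 t a : ~~ ((0 < a) && (a <= l)) -> all (leq 1) t -> all (geq l) t ->
      count_mem a t = 0.
    move=> Na t1 tl; apply/count_memPn; apply: contra Na => at_.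
    by apply/andP; split; [exact: (allP t1 _ at_)|exact: (allP tl _ at_)].
  suff H a : count_mem a (part_of_mults m) = count_mem a s.
    by rewrite /perm_eq; apply/allP => a _ /=; apply/eqP.
  case: (boolP ((0 < a) && (a <= l))) => [|Na].
    case: a => // a al; by rewrite (count_part_of_mults m (Ordinal al)) mE.
  rewrite !count0 //.
    by case/andP: (is_part_part_of_mults m).
  apply/allP => b; rewrite mem_sort => /flattenP[t /mapP[j _ ->]].
  by rewrite mem_nseq => /andP[_ /eqP ->]; apply: ltn_ord.
by exists m => //; rewrite -sumn_part_of_mults Pm.
Qed.

Lemma partition_enum l : exists p : 'I_(partitions l) -> seq nat,
  [/\ injective p, forall j, is_part (p j), forall j, sumn (p j) = l &
      forall s, is_part s -> sumn s = l -> exists j, p j = s].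
Proof.
pose P := [pred m : {ffun 'I_l -> 'I_l.+1} | \sum_(j < l) j.+1 * m j == l].
exists (fun j : 'I_#|P| => part_of_mults (enum_val j)); split.
- move=> j j' Hjj; apply: enum_val_inj; apply/ffunP => a; apply: val_inj => /=.
  by rewrite -!count_part_of_mults Hjj.
- by move=> j; apply: is_part_part_of_mults.
- by move=> j; rewrite sumn_part_of_mults; apply/eqP; have := enum_valP j.
move=> s Hs sl; have [m /eqP Hm <-] := part_of_mults_counts Hs sl.
have mP : m \in P by [].
by exists (enum_rank_in mP m); rewrite enum_rankK_in.
Qed.
End Partitions.

(** * Uniserial modules *)

Section UniserialModule.
Context {C : fieldType} {I : Type} {W : lmodType C} (op : I -> W -> W).
Context (theta : W -> W) (k : nat).
Definition iter_ker (j : nat) : set W := [set w | iter j theta w = 0].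

(* The submodules are the kernels of the powers of a nilpotent endomorphism
   which is as regular as possible. *)
Definition uniserial : Prop :=
  [/\ module_endomorphism op theta,
      forall w, iter k theta w = 0,
      forall j w, (j <= k)%N -> iter_ker j w -> exists w', w = iter (k - j) theta w',
      forall j, (j < k)%N -> ~ iter_ker j.+1 `<=` iter_ker j &
      forall S, submodule op S <-> exists2 j, (j <= k)%N & S = iter_ker j].

Hypothesis HU : uniserial.
Hypothesis k_gt0 : (0 < k)%N.

Let lin_theta m : linear (iter m theta).
Proof. by case: HU => -[H _] *; apply: linear_iter. Qed.

Let theta_op m n w : iter m theta (op n w) = op n (iter m theta w).
Proof. by case: HU => -[_ H] *; elim: m => //= m ->. Qed.

Let iter_k w : iter k theta w = 0. Proof. by case: HU. Qed.

Lemma submodule_iter_ker j : (j <= k)%N -> submodule op (iter_ker j).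
Proof. by case: HU => _ _ _ _ H jk; apply/H; exists j. Qed.

Lemma iter_ker0 : iter_ker 0 = [set 0].
Proof. by apply/seteqP; split. Qed.

Lemma iter_kerT : iter_ker k = setT.
Proof. by apply/seteqP; split=> // w _; apply: iter_k. Qed.

Lemma iter_ker_le j j' : (j <= j')%N -> iter_ker j `<=` iter_ker j'.
Proof.
by move=> /subnK <- w Hw; rewrite /iter_ker /= iterD Hw (lin0 (lin_theta _)).
Qed.

Lemma iter_ker_sub j j' : (j <= k)%N -> iter_ker j `<=` iter_ker j' -> (j <= j')%N.
Proof.
move=> jk sub; rewrite leqNgt; apply/negP => j'j.
case: HU => _ _ _ /(_ j' (leq_trans j'j jk)) + _; apply.
by apply: subset_trans sub; apply: iter_ker_le.
Qed.

Lemma iter_ker_inj j j' : (j <= k)%N -> (j' <= k)%N -> iter_ker j = iter_ker j' -> j = j'.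
Proof.
move=> jk j'k E; apply/eqP; rewrite eqn_leq.
by rewrite (iter_ker_sub (j := j)) ?E // (iter_ker_sub (j := j')) ?E.
Qed.

Lemma iter_ker_neq0 j : (0 < j <= k)%N -> iter_ker j <> [set 0].
Proof. by case/andP => j0 jk; rewrite -iter_ker0 => /(iter_ker_inj jk (leq0n _)); lia. Qed.

(** The kernel of [theta ^ j] is the image of [theta ^ (k - j)]. The isomorphism is the inverse of
    the one induced by [theta ^ (k - j)], realized by a choice of preimages. *)
Lemma uniserial_quotient j : (j <= k)%N ->
  subquotient_iso op op (iter_ker j) [set 0] setT (iter_ker (k - j)).
Proof.
move=> jk; case: HU => _ _ H _ _.
have /choice[f Hf] : forall w, exists w', iter_ker j w -> w = iter (k - j) theta w'.
  move=> w; case: (pselect (iter_ker j w)) => [|Hw]; last by exists 0.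
  by move=> /[dup] Hw /(H _ _ jk)[w' ->]; exists w'.
have [[S0 Slin] Sop] := submodule_iter_ker jk.
exists f; split=> //.
- move=> a u v Hu Hv; rewrite /iter_ker /= (linB (lin_theta _)) (lin_theta (k - j)).
  by rewrite -(Hf _ Hu) -(Hf _ Hv) -(Hf _ (Slin a u v Hu Hv)) subrr.
- move=> n w Hw; rewrite /iter_ker /= (linB (lin_theta _)) theta_op.
  by rewrite -(Hf _ Hw) -(Hf _ (Sop n w Hw)) subrr.
- by move=> w Hw; rewrite /iter_ker /= -(Hf _ Hw).
move=> w _; have Hw : iter_ker j (iter (k - j) theta w).
  by rewrite /iter_ker /= -iterD subnKC.
exists (iter (k - j) theta w) => //.
by rewrite /iter_ker /= (linB (lin_theta _)) -(Hf _ Hw) subrr.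
Qed.

(** Induced by [theta ^ j]; it is onto because [iter_ker 1] is the image of [theta ^ (k - 1)]. *)
Lemma uniserial_layer j : (j < k)%N ->
  subquotient_iso op op (iter_ker j.+1) (iter_ker j) (iter_ker 1) [set 0].
Proof.
move=> jk; exists (iter j theta); split=> //.
- by move=> a u v _ _; rewrite (lin_theta j) subrr.
- by move=> n w _; rewrite theta_op subrr.
case: HU => _ _ H _ _ w /(H _ _ k_gt0)[w' ->].
exists (iter (k - j.+1) theta w'); first by have := iter_k w'; rewrite -[X in iter X](subnKC jk) iterD.
rewrite -iterD (_ : (j + (k - j.+1) = k - 1)%N) ?subrr //; lia.
Qed.

(** Submodules form a chain, so the intersection of two is the smaller one. *)
Lemma uniserial_indecomposable j : (0 < j <= k)%N -> indecomposable op (iter_ker j).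
Proof.
move=> Hj; split; first exact: iter_ker_neq0.
case: HU => _ _ _ _ H A B /H[a ak ->] /H[b bk ->] AB _.
case: (leqP a b) AB => [/iter_ker_le|/ltnW/iter_ker_le] ab.
  by rewrite setIidl // => ->; left.
by rewrite setIidr // => ->; right.
Qed.

Lemma uniserial_irreducible : irreducible_module op <-> k = 1%N.
Proof.
case: HU => _ _ _ _ H; split=> [[_ _ /(_ (iter_ker 1))]|k1].
  case=> //; first by apply/H; exists 1%N.
    by rewrite -iter_ker0 => /(iter_ker_inj k_gt0 (leq0n _)).
  by rewrite -iter_kerT => /(iter_ker_inj k_gt0 (leqnn _)).
split; first by rewrite -iter_kerT; apply/H; exists k.
  by rewrite -iter_kerT; apply: iter_ker_neq0; rewrite k_gt0 leqnn.
move=> S /H[j]; rewrite k1; case: j => [|[|//]] _ ->; first by left; exact: iter_ker0.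
by right; rewrite -k1 iter_kerT.
Qed.

Lemma uniserial_simple S : simple_submodule op S <-> S = iter_ker 1.
Proof.
case: HU => _ _ _ _ H; split=> [[/H[j jk ->]]|->].
  case: j jk => [|j] jk; first by rewrite iter_ker0.
  move=> _ /(_ (iter_ker 1) (submodule_iter_ker k_gt0)).
  case=> [|/esym S0|//]; first exact: iter_ker_le.
  by case: (iter_ker_neq0 (j := 1)); rewrite ?k_gt0.
split; first exact: submodule_iter_ker.
  by apply: iter_ker_neq0; rewrite k_gt0.
move=> S' /H[[|j] jk ->] sub; first by left; exact: iter_ker0.
by right; congr iter_ker; have := iter_ker_sub jk sub; lia.
Qed.

Lemma uniserial_socle : socle op = iter_ker 1.
Proof.
apply/seteqP; split=> w; last first.
  by move=> Hw; apply: sub_lspan; exists (iter_ker 1) => //; apply/uniserial_simple.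
apply: lspan_min; first exact: (submodule_iter_ker k_gt0).1.
by move=> v [S /uniserial_simple ->].
Qed.

Lemma uniserial_radical : radical op = iter_ker k.-1.
Proof.
case: HU => _ _ _ _ H; have pk : (k.-1 <= k)%N by lia.
apply/seteqP; split=> [w|w Hw S [/H[j jk ->]] SN maxS].
  apply; split; first exact: submodule_iter_ker.
    by rewrite -iter_kerT => /(iter_ker_inj pk (leqnn _)); lia.
  move=> _ /H[j jk ->] /(iter_ker_sub pk) Hj; case: (ltngtP j k) => jk'; try lia.
    by left; congr iter_ker; lia.
  by right; rewrite jk' iter_kerT.
have jltk : (j < k)%N.
  by rewrite ltn_neqAle jk andbT; apply/eqP => jE; case: SN; rewrite jE iter_kerT.
have [| |<- //|] := maxS (iter_ker k.-1).
- exact: submodule_iter_ker.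
- by apply: iter_ker_le; lia.
by rewrite -iter_kerT => /(iter_ker_inj pk (leqnn _)); lia.
Qed.
End UniserialModule.

(** * Bases of the weight spaces from partitions and a Jordan chain *)

Section FiniteBases.
Context {C : fieldType} {W : lmodType C}.

Lemma subspace_combinations (J : finType) (b : J -> W) :
  subspace [set w | exists a : J -> C, w = \sum_j a j *: b j].
Proof.
split; first by exists (fun=> 0); rewrite big1 // => j _; rewrite scale0r.
move=> a _ _ [u ->] [v ->]; exists (fun j => a * u j + v j).
rewrite scaler_sumr -big_split; apply: eq_bigr => j _.
by rewrite scalerDl scalerA.
Qed.

Lemma combination_basis (J : finType) (b : J -> W) j :
  exists a : J -> C, b j = \sum_j' a j' *: b j'.
Proof.
exists (fun j' => (j' == j)%:R); rewrite (bigD1 j) //= eqxx scale1r big1 ?addr0 //.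
by move=> j' /negbTE ->; rewrite scale0r.
Qed.

Lemma is_basis_bij (S : set W) (J J' : finType) (b : J -> W) (f : J' -> J) :
  bijective f -> is_basis S b -> is_basis S (fun j => b (f j)).
Proof.
move=> Hf [span free]; case: (Hf) => g fK gK; split=> [w|a Ha j].
  rewrite span; split=> -[a ->].
    by exists (a \o f); rewrite (reindex f) //; apply: onW_bij.
  exists (a \o g); rewrite [RHS](reindex f) /=; last exact: onW_bij.
  by apply: eq_bigr => j _; rewrite fK.
have /free/(_ (f j)) : \sum_j a (g j) *: b j = 0.
  rewrite (reindex f) /=; last exact: onW_bij.
  by rewrite -[RHS]Ha; apply: eq_bigr => j' _; rewrite fK.
by rewrite fK.
Qed.

Lemma has_dim_basis (S : set W) (J : finType) (b : J -> W) :
  is_basis S b -> has_dim S #|J|.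
Proof.
by move=> Hb; exists (fun j => b (enum_val j)); apply: is_basis_bij Hb; exact: enum_val_bij.
Qed.
End FiniteBases.

Section DegreeBasis.
Context {C : numFieldType} (c h : C) (k : nat).
Context {U : vectType C} (x : U -> U) (Hx : linear x).
Context {W : lmodType C} (L : int -> W -> W) (i : U -> W).
Hypothesis hW : induced_module c x L i.
Context (e : nat -> U).
Hypothesis He : jordan_chain (fun u => x u - h *: u) k e.
Context (l : nat) (p : 'I_(partitions l) -> seq nat).
Hypothesis p_inj : injective p.
Hypothesis p_part : forall t, is_part (p t).
Hypothesis p_sum : forall t, sumn (p t) = l.
Hypothesis p_onto : forall s, is_part s -> sumn s = l -> exists t, p t = s.

Let lini : linear i := linear_i hW.
Let lin_word s : linear (word L s) := linear_word (linear_L hW) s.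

(** Partition monomials of degree l applied to the first [j] chain vectors. The case j = k gives the
    whole weight space, the case j = 1 its intersection with the socle. *)
Lemma degree_basis j : (j <= k)%N ->
  is_basis (chain_sub Hx hW He j `&` L0_space L (h + l%:R))
    (fun q : 'I_j * 'I_(partitions l) => word L (p q.2) (i (e q.1))).
Proof.
move=> jk; set b := (fun q : 'I_j * 'I_(partitions l) => _); split=> [w|a Ha [m t]].
  split=> [[wj wl]|[a ->]].
    have [r [Hr _ ->]] := pbw_decomp Hx hW w.
    apply: (subspace_sum_seq (subspace_combinations b)) => s sr.
    have Hs := allP Hr _ sr; case: (eqVneq (sumn s) l) => [sl|sl]; last first.
      rewrite (coord_L0_space Hx hW He Hs wl).
        by rewrite (lin0 lini) (lin0 (lin_word _)); exact: (subspace_combinations b).1.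
      by move/addrI/eqP; rewrite eqr_nat (negbTE sl).
    have [t <-] := p_onto Hs sl.
    have [a ->] : exists a : nat -> C, pbw_coord Hx hW (p t) w = \sum_(m < j) a m *: e m.
      apply: (ker_chain He jk); rewrite -(coord_iter_theta Hx hW He) // wj.
      by rewrite (lin0 (linear_coord Hx hW _)).
    rewrite (lin_sum lini) (lin_sum (lin_word _)).
    apply: (subspace_sum _ (subspace_combinations b)) => m _.
    rewrite (linZ lini) (linZ (lin_word _)).
    apply: (subspaceZ _ (subspace_combinations b)).
    exact: (combination_basis b (m, t)).
  have HS : subspace (chain_sub Hx hW He j `&` L0_space L (h + l%:R)).
    rewrite -(degree_L0_space Hx hW He).
    by apply: subspaceI; [exact: subspace_chain_sub|exact: subspace_lspan].
  apply: (subspace_sum _ HS) => q _; apply: (subspaceZ _ HS); split.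
    apply: word_submodule; first exact: submodule_chain_sub.
    by apply/chain_sub_e => //; apply: leq_trans (ltn_ord q.1) jk.
  rewrite -(degree_L0_space Hx hW He); apply: sub_lspan.
  exists (p q.2), (e q.1); split=> //.
  by case/andP: (p_part q.2).
have := congr1 (pbw_coord Hx hW (p t)) Ha.
rewrite (lin0 (linear_coord Hx hW _)) (lin_sum (linear_coord Hx hW _)).
pose A n := if insub n is Some m' then a (m', t) else 0.
have -> : \sum_q pbw_coord Hx hW (p t) (a q *: b q) =
    \sum_(m < j) A m *: e m.
  transitivity (\sum_(m < j) \sum_t' pbw_coord Hx hW (p t) (a (m, t') *: b (m, t'))).
    by rewrite pair_bigA; apply: eq_bigr => -[].
  apply: eq_bigr => m' _; rewrite /A valK (bigD1 t) //= big1 => [|t' /negbTE t't].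
    by rewrite addr0 (linZ (linear_coord Hx hW _)) coord_word // eqxx.
  rewrite (linZ (linear_coord Hx hW _)) coord_word // (inj_eq p_inj) t't.
  by rewrite scaler0.
by move/(chain_free He (a := A) jk)/(_ m (ltn_ord m)); rewrite /A valK.
Qed.
End DegreeBasis.

(** * Block matrices of operators commuting with the shift *)

Section BlockForm.
Context {C : fieldType} {V : voa C} {W : vmodule V} (theta : W -> W) (lin_theta : linear theta).
Context (K d : nat) (S : set W) (b : nat -> 'I_d -> W).
Hypothesis Hb : jordan_blocks theta K S b.
Context (sigma : W -> W) (Hs : linear sigma).
Hypothesis Hc : forall w, sigma (theta w) = theta (sigma w).

(** The last block column of [X] records [sigma] on the basis [b K]. Its block in row [K - m]
    collects the coefficients of t^m, so [B], in row 0, belongs to t^K. *)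
Lemma block_form_poly X A D B :
  block_matrix_of K.+1 b sigma X -> block_form K.+1 X A D B ->
  exists2 P : 'M[{poly C}]_d,
    forall s, sigma (b K s) = \sum_r pact theta (P r s) (b K r) & (\tr P)`_K = \tr B.
Proof.
move=> HX [_ _ _ <- _].
exists (\matrix_(r, s) \poly_(m < K.+1) X (K - m)%N K r s) => [s|].
  rewrite HX // (sum_pact_blocks lin_theta Hb) pair_bigA /=.
  apply: eq_bigr => -[m r] _ /=; congr (_ *: _).
  have mK : (m <= K)%N by rewrite -ltnS.
  by rewrite mxE coef_poly ltnS leq_subr subKn.
rewrite coef_sum; apply: eq_bigr => r _.
by rewrite mxE coef_poly ltnSn subnn.
Qed.

Hypothesis HS : forall w, S w -> S (sigma w).

(* Since [sigma] commutes with the shift [theta] of the blocks, its matrix is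
   block Toeplitz. *)
Lemma jordan_block_form : exists X A D B,
  block_matrix_of K.+1 b sigma X /\ block_form K.+1 X A D B.
Proof.
have [P HP] := blocks_matrix lin_theta Hb (fun s => HS (blocks_in Hb s (leqnn K))).
pose T m : 'M_d := \matrix_(r, s) (P r s)`_m.
(* The block (m, j) is the coefficient matrix of t^(j - m); the claimed first row and last column
   are then both read off [T]. *)
exists (fun m j => if (m <= j)%N then T (j - m)%N else 0), (T 0%N), T, (T K).
split; last first.
  split=> [m j Hm|m _|j _||j Hm]; rewrite /= ?leqnn ?subnn ?leq0n ?subn0 //.
    by rewrite leqNgt (andP Hm).1.
  by move: Hm => /= Hm; rewrite leq_subr subKn //; lia.
move=> j s; rewrite ltnS => jK.
have jE : b j s = iter (K - j) theta (b K s).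
  by rewrite (iter_blocks Hb) ?subKn ?leq_subr ?leqnn.
have Hci n w : sigma (iter n theta w) = iter n theta (sigma w).
  by elim: n => //= n <-.
rewrite jE Hci HP (lin_sum (linear_iter _ lin_theta)) [RHS]exchange_big /=.
apply: eq_bigr => r _; rewrite (pact_comm _ _ (linear_iter _ lin_theta)); last first.
  by move=> w; rewrite -iterSr.
rewrite (iter_blocks Hb) ?leq_subr ?leqnn // subKn //.
have bj0 : iter j.+1 theta (b j r) = 0.
  by rewrite iterS (iter_blocks Hb) ?leqnn // subnn (Hb.2 r).1.
rewrite (pact_trunc lin_theta _ bj0) (reindex_inj rev_ord_inj) /=.
rewrite [RHS](eq_bigr (fun m : 'I_K.+1 =>
  if (m < j.+1)%N then T (j - m)%N r s *: b m r else 0)); last first.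
  by move=> m _; rewrite ltnS; case: ifP => // _; rewrite mxE scale0r.
rewrite -big_mkcond -(big_ord_widen _ (fun m => T (j - m)%N r s *: b m r)) ?ltnS //.
apply: eq_bigr => m _; have mj : (m <= j)%N by rewrite -ltnS.
by rewrite subSS mxE (iter_blocks Hb) ?leq_subr ?subKn.
Qed.
End BlockForm.

(** * Interlocking and pseudo-traces *)

Section StronglyInterlocked.
Context {C : numFieldType} (c h : C) (K : nat).
Context {V : voa C} (hV : is_universal_virasoro_voa c V).
Context {M : lmodType C} (LM : int -> M -> M) (v0 : M).
Hypothesis hM : verma_module c h LM v0.
Hypothesis hT : maximal_proper_submodule LM [set 0].
Context {W : vmodule V} {U : vectType C} (x : U -> U) (Hx : linear x) (i : U -> W).
Hypothesis hW : induced_module c x (vmodL W) i.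
Context (e : nat -> U).
Hypothesis He : jordan_chain (fun u => x u - h *: u) K.+1 e.

Notation theta := (theta Hx hW He).
Notation chain j := (iter_ker theta j).
Let lin_theta : linear theta := linear_theta Hx hW He.
Let linL n : linear (vmodL W n) := linear_L hW n.

Lemma theta_uniserial : uniserial (modes W) theta K.+1.
Proof.
have HS (S : set W) := submodule_modes hV S.
split.
- by apply/(endomorphism_modes hV); split=> // n w; rewrite theta_L.
- exact: iter_theta0.
- by move=> j w jk; apply: chain_sub_image.
- move=> j jk; have [_ H] := chain_sub_lt Hx hW He jk; exact: H.
move=> S; rewrite HS; split; first exact: (submodule_class _ _ _ _ hM hT).
by move=> [j _ ->]; apply: submodule_chain_sub.
Qed.
Let HU := theta_uniserial.

Lemma uniserial_interlocked j : (j <= K.+1)%N ->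
  interlocked (chain j) (chain (K.+1 - j)).
Proof.
move=> jk; split; first exact: (uniserial_quotient HU).
by have := uniserial_quotient HU (leq_subr j K.+1); rewrite subKn.
Qed.

Lemma weight_degree l : degree_space (vmodL W) i l = weight_space W (h + l%:R).
Proof. exact: (degree_L0_space Hx hW He). Qed.

Lemma degree_blocks l : exists b : nat -> 'I_(partitions l) -> W,
  jordan_blocks theta K (weight_space W (h + l%:R)) b /\
  is_basis (chain 1 `&` weight_space W (h + l%:R)) (b 0%N).
Proof.
have [p [p_inj p_part p_sum p_onto]] := partition_enum l.
have Hb := degree_basis Hx hW He p_inj p_part p_sum p_onto.
exists (fun j t => word (vmodL W) (p t) (i (e j))); split; last first.
  have f_bij : bijective (fun t : 'I_(partitions l) => (ord0 : 'I_1, t)).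
    by exists snd => [t //|[m t] /=]; rewrite [m]ord1.
  exact: (is_basis_bij f_bij (Hb 1%N isT)).
split.
  have := Hb K.+1 (leqnn _); rewrite [chain_sub _ _ _ _]chain_subT setTI.
  exact.
have [_ _ _ e0 eS] := He.
move=> t; rewrite theta_word theta_i e0 (lin0 (linear_i hW)).
rewrite (lin0 (linear_word linL _)); split=> // j jK.
by rewrite theta_word theta_i eS.
Qed.

(** Weights outside h + N have zero weight space and receive blocks of size 0, since a family of
    bases ranges over all [mu]. *)
Lemma weight_blocks mu : exists d (b : nat -> 'I_d -> W),
  jordan_blocks theta K (weight_space W mu) b /\
  is_basis (chain 1 `&` weight_space W mu) (b 0%N).
Proof.
case: (pselect (exists l : nat, mu = h + l%:R)) => [[l ->]|Hmu].
  by have [b Hb] := degree_blocks l; exists (partitions l), b.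
have w0 w : weight_space W mu w -> w = 0.
  by apply: (L0_space_trivial Hx hW He) => l Hl; apply: Hmu; exists l.
have ww : weight_space W mu 0 by exists 0%N.
exists 0%N, (fun _ _ => 0); split.
  split; last by case.
  split=> [w|a _ [m []] //].
  split=> [/w0 ->|[a ->]]; first by exists (fun=> 0); rewrite big1 // => -[m []].
  by rewrite big1 // => -[m []].
split=> [w|a _ [] //].
split=> [[_ /w0 ->]|[a ->]]; first by exists (fun=> 0); rewrite big_ord0.
by rewrite big_ord0; split=> //; apply: lin0.
Qed.

Lemma uniserial_generalized : generalized_module W.
Proof.
split.
- apply/seteqP; split=> // w _; have := degree_span Hx hW w.
  move: w; apply: lspan_min; first exact: subspace_lspan.
  move=> w [l _]; rewrite weight_degree => Hw; apply: sub_lspan.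
  by exists (h + l%:R).
- by move=> mu; have [d [b [[Hb _] _]]] := weight_blocks mu; eexists; apply: has_dim_basis Hb.
move=> mu; case: (pselect (exists z : int, mu - h = z%:~R)) => [[z Hz]|Hz]; last first.
  exists 0 => n _; apply/seteqP; split=> [w Hw|_ ->]; last by exists 0%N.
  apply: (L0_space_trivial Hx hW He) Hw => l Hl; apply: Hz.
  exists (l%:Z - n); rewrite rmorphB /= -[mu](addrK n%:~R) Hl.
  by rewrite -pmulrn; ring.
(* As mu + n = h + (z + n), a nonzero weight space requires z + n >= 0. *)
exists (- z) => n nz; apply/seteqP; split=> [w Hw|_ ->]; last by exists 0%N.
apply: (L0_space_trivial Hx hW He) Hw => l Hl.
have /eqP : (z + n)%:~R = l%:Z%:~R :> C.
  by rewrite rmorphD /= -Hz -pmulrn -[RHS](addKr h) -Hl; ring.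
by rewrite eqr_int; lia.
Qed.

Lemma uniserial_strongly_interlocked : strongly_interlocked_length W K.+1.
Proof.
split.
  split; first exact: uniserial_generalized.
    by rewrite -(iter_kerT HU); apply: (uniserial_indecomposable HU isT); rewrite leqnn.
  case: HU => _ _ _ _ H S /H[j jk ->].
  exists (chain (K.+1 - j)); last exact: uniserial_interlocked.
  by apply/H; exists (K.+1 - j)%N; rewrite // leq_subr.
case: (posnP K) => [K0|K0].
  by left; rewrite K0; split=> //; apply/(uniserial_irreducible HU) => //; rewrite K0.
right; split=> //; split; first by move/(uniserial_irreducible HU isT); lia.
exists (fun j => chain j); split.
- by rewrite iter_ker0 (iter_kerT HU).
- move=> j jk; split; first exact: (iter_ker_le HU).
  by case: HU => _ _ _ H _; apply: H.
- move=> j /andP[j0 jk]; split; first exact/(submodule_iter_ker HU)/ltnW.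
  by apply: (uniserial_indecomposable HU isT); rewrite j0 ltnW.
- case: HU => _ _ _ _ H S /H[j jk ->] S0 ST; exists j => //.
  rewrite lt0n ltn_neqAle jk andbT; apply/andP; split; apply/eqP => jE.
    by apply: S0; rewrite jE iter_ker0.
  by apply: ST; rewrite jE (iter_kerT HU).
by move=> j jk; apply: (uniserial_layer HU isT).
Qed.

(** Modes commute with [theta] because it is a module endomorphism. Endomorphisms commute with L_0
    and so preserve each weight space, where [theta] is L_0 - mu. *)
Lemma generated_commutes (sigma : W -> W) :
  generated_algebra (range (modes W) `|` [set f | module_endomorphism (modes W) f]) sigma ->
  linear sigma /\ forall w, sigma (theta w) = theta (sigma w).
Proof.
have [_ theta_op] : module_endomorphism (modes W) theta by case: HU.
elim => [f [[[v n] _ <-]|[Hf fop]]||a f g _ [Hf fc] _ [Hg gc]|f g _ [Hf fc] _ [Hg gc]].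
- by split; [apply: vmod_linear_r|move=> w; rewrite theta_op].
- have fL n w : f (vmodL W n w) = vmodL W n (f w) by apply: (fop (voa_omega V, n + 1)).
  split=> // w; have := degree_span Hx hW w.
  move: w; apply: (lspan_min (S := [set w | f (theta w) = theta (f w)])).
    by apply: subspace_eq; apply: linear_comp.
  move=> w [l _]; rewrite weight_degree => Hw /=.
  have Hfw : weight_space W (h + l%:R) (f w).
    case: Hw => n Hn; exists n.
    suff -> : iter n (fun u => vmodL W 0 u - (h + l%:R) *: u) (f w) =
        f (iter n (fun u => vmodL W 0 u - (h + l%:R) *: u) w).
      by rewrite Hn (lin0 Hf).
    by elim: (n) => //= m ->; rewrite (linB Hf) (linZ Hf) fL.
  rewrite (theta_L0_space Hx hW He Hw) (theta_L0_space Hx hW He Hfw).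
  by rewrite (linB Hf) (linZ Hf) fL.
- by split=> //; apply: linear_id.
- split; first by apply: linear_add => //; apply: linear_scale.
  by move=> w; rewrite (linD lin_theta) (linZ lin_theta) fc gc.
- by split; [apply: linear_comp|move=> w /=; rewrite gc fc].
Qed.

Lemma weight_preserving_block_form sigma mu d (b : nat -> 'I_d -> W) :
  jordan_blocks theta K (weight_space W mu) b -> weight_preserving_operator sigma ->
  exists X A D B, block_matrix_of K.+1 b sigma X /\ block_form K.+1 X A D B.
Proof.
move=> Hb [Hs Hw /generated_commutes[_ Hc]].
exact: (jordan_block_form lin_theta Hb Hc (Hw mu)).
Qed.

(** On W_mu the operator [theta] is L_0 - mu, so the Jordan normalization of the family is the shift
    condition of [jordan_blocks]. *)
Lemma pstr_family_blocks (b : basis_family W) mu : pstr_family K.+1 b ->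
  jordan_blocks theta K (weight_space W mu) (fam_vec b mu).
Proof.
move=> [Hb HL]; have [Hbasis _ _] := Hb mu; split=> // s.
have inW j : (j < K.+1)%N -> weight_space W mu (fam_vec b mu j s).
  move=> jk; apply/(Hbasis.1 _).
  exact: (combination_basis (fun q : 'I_K.+1 * _ => fam_vec b mu q.1 q.2) (Ordinal jk, s)).
have [H0 HS] := HL mu s; split.
  by rewrite (theta_L0_space Hx hW He (inW 0%N isT)) H0 subrr.
move=> j jK; rewrite (theta_L0_space Hx hW He (inW j.+1 jK)) HS //.
by rewrite addrC addKr.
Qed.

Lemma pstr_family_exists : exists b : basis_family W, pstr_family K.+1 b.
Proof.
have /choice[f Hf] : forall mu, exists p : {d : nat & nat -> 'I_d -> W},
    jordan_blocks theta K (weight_space W mu) (projT2 p) /\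
    is_basis (chain 1 `&` weight_space W mu) (projT2 p 0%N).
  by move=> mu; have [d [b Hb]] := weight_blocks mu; exists (existT _ d b).
exists (BasisFamily (fam_dim := fun mu => projT1 (f mu)) (fun mu => projT2 (f mu))).
split=> [mu|mu s] /=.
  have [Hb H1] := Hf mu; split; first exact: Hb.1.
    by rewrite (uniserial_socle HU isT); exact: H1.
  by move=> sigma; exact: (weight_preserving_block_form Hb).
have [Hb _] := Hf mu; have [t0 tS] := Hb.2 s.
have L0E j : (j <= K)%N -> vmodL W 0 (projT2 (f mu) j s) =
    mu *: projT2 (f mu) j s + theta (projT2 (f mu) j s).
  move=> jK; rewrite (theta_L0_space Hx hW He (blocks_in Hb s jK)).
  by rewrite addrC subrK.
split; first by rewrite L0E // t0 addr0.
by move=> j jK; rewrite L0E ?tS.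
Qed.

Lemma tr_B_unique (sigma : W -> W) mu (b b' : basis_family W) t t' : weight_preserving_operator sigma ->
  pstr_family K.+1 b -> pstr_family K.+1 b' ->
  tr_B K.+1 b sigma mu t -> tr_B K.+1 b' sigma mu t' -> t = t'.
Proof.
move=> [Hs _ /generated_commutes[_ Hc]] Hb Hb'.
move=> [X [A [D [B [HX HB ->]]]]] [X' [A' [D' [B' [HX' HB' ->]]]]].
have Jb := pstr_family_blocks mu Hb; have Jb' := pstr_family_blocks mu Hb'.
have [P HP <-] := block_form_poly lin_theta Jb HX HB.
have [P' HP' <-] := block_form_poly lin_theta Jb' HX' HB'.
exact: (trace_blocks lin_theta Hs Hc Jb Jb' HP HP').
Qed.

Lemma tr_B_exists (sigma : W -> W) mu (b : basis_family W) : weight_preserving_operator sigma ->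
  pstr_family K.+1 b -> exists t, tr_B K.+1 b sigma mu t.
Proof.
move=> Hs [Hb _]; have [_ _ /(_ _ Hs)[X [A [D [B [HX HB]]]]]] := Hb mu.
by exists (\tr B), X, A, D, B.
Qed.

(** The value precedes the hypothesis on [sigma], with 0 as default, so that choice yields a
    function of all pairs in [graded_pstr_unique]. *)
Lemma pstr_exists (sigma : W -> W) mu : exists t : C, weight_preserving_operator sigma ->
  forall b : basis_family W, pstr_family K.+1 b -> forall t', tr_B K.+1 b sigma mu t' <-> t' = t.
Proof.
case: (pselect (weight_preserving_operator sigma)) => [Hs|]; last by exists 0.
have [b0 Hb0] := pstr_family_exists; have [t Ht] := tr_B_exists mu Hs Hb0.
exists t => _ b Hb t'; split=> [Ht'|->]; first exact: (tr_B_unique Hs Hb Hb0 Ht' Ht).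
have [t2 Ht2] := tr_B_exists mu Hs Hb.
by rewrite (tr_B_unique Hs Hb0 Hb Ht Ht2).
Qed.

Lemma uniserial_pstr_well_defined : pstr_well_defined W K.+1.
Proof.
split; first exact: pstr_family_exists.
by move=> sigma mu Hs; have [t Ht] := pstr_exists sigma mu; exists t; apply: Ht.
Qed.

Lemma theta_nilpotent_part : L0_nilpotent_part theta.
Proof.
split=> //; first by move=> mu w; apply: theta_L0_space.
move=> /(uniserial_irreducible HU isT) [K0] w.
(* Irreducibility forces K = 0, where nilpotency already reads theta = 0. The generic [n] avoids
   rewriting [K] inside [theta]. *)
have iter_eq0 n : n = 0%N -> iter n.+1 theta w = 0 -> theta w = 0 by move=> ->.
exact: iter_eq0 K0 (iter_theta0 Hx hW He w).
Qed.

Lemma weight_preserving_pstr_operator v j :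
  weight_preserving_operator
    (fun w : W => zero_mode v ((j`!%:R)^-1 *: iter j theta w)).
Proof.
have [Hz zw zg] := weight_preserving_zero_mode W v.
have lin_j := linear_iter j lin_theta; split.
- by apply: linear_comp => //; apply: linear_scale.
- move=> mu w Hw; apply: zw; apply: subspaceZ; first exact: subspace_weight_space.
  elim: (j) => //= m [n Hn]; exists n.
  have E u : vmodL W 0 (theta u) - mu *: theta u = theta (vmodL W 0 u - mu *: u).
    by rewrite (linB lin_theta) (linZ lin_theta) theta_L.
  suff -> : forall u, iter n (fun u => vmodL W 0 u - mu *: u) (theta u) =
      theta (iter n (fun u => vmodL W 0 u - mu *: u) u).
    by rewrite Hn (lin0 lin_theta).
  by move=> u; elim: (n) => //= q ->; rewrite E.
set S := (X in generated_algebra X).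
have gen0 a f : generated_algebra S f -> generated_algebra S (fun w => a *: f w).
  move=> Hf; have -> : (fun w => a *: f w) = (fun w => a *: f w + ((-1) *: id w + id w)).
    by apply/funext => w; rewrite scaleN1r addNr addr0.
  by do !apply: GenAlgLin => //; apply: GenAlgOne.
apply: (GenAlgMul zg (g := fun w => (j`!%:R)^-1 *: iter j theta w)); apply: gen0.
elim: j {lin_j} => [|j IH]; first exact: GenAlgOne.
apply: (GenAlgMul _ IH (f := theta)); apply: GenAlgBase; right.
by case: HU.
Qed.

Lemma graded_pstr_unique v : exists! a : C -> nat -> C, graded_pstr W K.+1 v a.
Proof.
have /choice[T HT] : forall q : (W -> W) * C, exists t, weight_preserving_operator q.1 ->
    forall b : basis_family W, pstr_family K.+1 b -> forall t', tr_B K.+1 b q.1 q.2 t' <-> t' = t.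
  by move=> [sigma mu]; apply: pstr_exists.
pose sg j := (fun w : W => zero_mode v ((j`!%:R)^-1 *: iter j theta w)).
have Hsg j : weight_preserving_operator (sg j) := weight_preserving_pstr_operator v j.
(* The exponent z of q is mu - c/24; adding c/24 recovers the weight. *)
exists (fun z j => T (sg j, z + voa_charge V / 24%:R)); split.
  exists theta; first exact: theta_nilpotent_part.
  move=> mu j; split; first exact: Hsg.
  by move=> b Hb; rewrite subrK; apply/(HT (sg j, mu) (Hsg j) b Hb).
move=> a [N [HN HNw _] Ha]; apply/funext => z; apply/funext => j.
have NE : N = theta by apply/funext; apply: theta_unique.
rewrite NE in Ha; have [b Hb] := pstr_family_exists.
have [_ /(_ b Hb)] := Ha (z + voa_charge V / 24%:R) j; rewrite addrK.
by move/(HT (sg j, z + voa_charge V / 24%:R) (Hsg j) b Hb) => ->.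
Qed.

(** The kernel is a submodule; if nonzero it contains [i (e 0)] by the classification. With y = id
    this vector would lie in positive degrees, yet its coordinate at the empty partition is
    [e 0]. *)
Lemma frakL0_kernel_trivial : frakL0_kernel (vmodL W) i = [set 0].
Proof.
set T := frakL0_kernel _ _.
have gen_lin y : generated_algebra (range (vmodL W)) y -> linear y.
  elim=> [f [n _ <-]//||a f g _ Hf _ Hg|f g _ Hf _ Hg]; first exact: linear_id.
    by apply: linear_add => //; apply: linear_scale.
  exact: linear_comp.
have HT : submodule (vmodL W) T.
  split; last first.
    move=> n w Hw y Hy; apply: (Hw (y \o vmodL W n)); apply: GenAlgMul => //.
    by apply: GenAlgBase; exists n.
  split=> [y /gen_lin Hy|a u v Hu Hv y Hy].
    by rewrite (lin0 Hy); apply: (subspace_lspan _).1.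
  by rewrite (gen_lin _ Hy); apply: (subspace_lspan _).2; [apply: Hu|apply: Hv].
have [[|j] jk TE] := submodule_class (ltn0Sn K) Hx hW He hM hT HT.
  by rewrite TE; exact: chain_sub0.
exfalso; have : T (i (e 0%N)) by rewrite TE; apply/chain_sub_e.
move=> /(_ id (GenAlgOne _)); set D := lspan _ => HD.
suff : pbw_coord Hx hW [::] (i (e 0%N)) = 0.
  by rewrite coord_i; case: He.
move: HD; move: (i (e 0%N)).
apply: (lspan_min (S := [set w | pbw_coord Hx hW [::] w = 0])).
  exact/subspace_ker/linear_coord.
move=> w [l /= l0]; rewrite weight_degree => Hw.
apply: (coord_L0_space Hx hW He _ Hw) => //= /addrI/eqP.
by rewrite (eqr_nat _ 0%N l); lia.
Qed.
End StronglyInterlocked.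

(** * The module [C[x]/((x-h)^k)] *)

Section Uchk.
Context {C : fieldType} (h : C) (K : nat).
Notation P := (('X - h%:P) ^+ K.+1 : {poly C}).
Notation U := (Uchk h K.+1).
Notation eps := (fun u : U => Ux h K.+1 u - h *: u).

Lemma linear_Ux : linear (Ux h K.+1).
Proof. by move=> a u v; rewrite /Ux mulrDr scalerAr. Qed.

Lemma mk_monic_XsubC_exp : mk_monic P = P.
Proof. by rewrite /mk_monic monic_exp ?monicXsubC // size_exp_XsubC. Qed.

Lemma iter_eps_in_qpoly n (q : {poly C}) :
  iter n eps (in_qpoly P q) = in_qpoly P (('X - h%:P) ^+ n * q).
Proof.
elim: n => [|n IH] /=; first by rewrite mul1r.
rewrite IH /Ux (exprS _ n) -mulrA; move: (_ ^+ n * q) => r.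
have -> : ('X - h%:P) * r = 'X * r + (- h) *: r.
  by rewrite mulrBl -mul_polyC polyCN mulNr.
by rewrite in_qpolyD in_qpolyM in_qpolyZ scaleNr.
Qed.

Lemma linear_eps : linear eps.
Proof. by apply: linear_sub; [exact: linear_Ux|apply: linear_scale; apply: linear_id]. Qed.

(** The chain is formed by the powers of x - h in decreasing order; they span by Taylor expansion at
    h. *)
Lemma Uchk_chain : jordan_chain eps K.+1 (fun b => iter (K - b) eps 1).
Proof.
have eps_it n : iter n eps 1 = in_qpoly P (('X - h%:P) ^+ n).
  by rewrite -in_qpoly1 iter_eps_in_qpoly mulr1.
split.
- exact: linear_eps.
(* The Taylor polynomial of v at h: v is q evaluated at X - h. *)
- move=> v; pose q := (v : {poly C}) \Po ('X + h%:P).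
  have sq : (size q <= K.+1)%N.
    rewrite size_comp_poly2 ?size_XaddC // (leq_trans (size_npoly v)) //.
    by rewrite mk_monic_XsubC_exp size_exp_XsubC.
  exists (fun b => q`_(K - b)).
  have -> : v = \sum_(m < size q) q`_m *: iter m eps 1.
    have {1}-> : v = in_qpoly P (v : {poly C}).
      by apply/val_inj; rewrite /= Pdiv.Ring.rmodp_small // size_mk_monic.
    rewrite -[in LHS](comp_polyXaddC_K v h) comp_polyE -/q.
    rewrite (big_morph (in_qpoly P) (@in_qpolyD _ P) (in_qpoly0 P)).
    by apply: eq_bigr => m _; rewrite in_qpolyZ eps_it.
  rewrite -[LHS]/(pact eps q 1) (pactE eps 1 sq) (reindex_inj rev_ord_inj).
  by apply: eq_bigr => m _ /=; rewrite subSS.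
- rewrite subn0 eps_it => /(congr1 val) /=; rewrite Pdiv.Ring.rmodp_small; last first.
    by rewrite mk_monic_XsubC_exp !size_exp_XsubC.
  by apply/eqP; rewrite expf_neq0 // polyXsubC_eq0.
- rewrite subn0 -[LHS]/(iter K.+1 eps 1) eps_it; apply/val_inj => /=.
  by rewrite mk_monic_XsubC_exp Pdiv.RingMonic.rmodpp // monic_exp // monicXsubC.
by move=> b bK; rewrite -[RHS]/(iter (K - b) eps 1) -(subnSK (bK : (b < K)%N)).
Qed.

Context (u : nat -> U) (Hu : jordan_basis u).

Lemma span_uptoP j v : v \in span_upto u j <->
  exists a : nat -> C, v = \sum_(b < j) a b *: u b.+1.
Proof.
pose X := map_tuple u (iota_tuple j 1).
have nthX (b : 'I_j) : X`_b = u b.+1.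
  by rewrite (nth_map 0%N) ?size_iota // nth_iota.
rewrite /span_upto -[[seq _ | _ <- _]]/(X : seq U); split=> [/coord_span ->|[a ->]].
  exists (fun b => if insub b is Some b' then coord X b' v else 0).
  by apply: eq_bigr => b _; rewrite valK nthX.
apply: rpred_sum => b _; apply: rpredZ; apply: memv_span.
by rewrite -nthX mem_nth // size_tuple.
Qed.

Lemma jordan_basis_chain : jordan_chain eps K.+1 (fun b => u b.+1).
Proof.
have [Hb u1 uS] := Hu; split.
- exact: linear_eps.
- by move=> v; apply/span_uptoP; rewrite /span_upto (span_basis Hb) memvf.
- have u1_in : u 1%N \in [seq u n | n <- iota 1 K.+1] by rewrite mem_head.
  by apply/eqP; apply: free_not0 u1_in; apply: basis_free Hb.
- by rewrite u1 subrr.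
by move=> b bK; rewrite uS // [LHS]addrAC subrr add0r.
Qed.
End Uchk.

(** * Modules attached to invariant subspaces of the degree zero space *)

Section FrakL0OfSubspace.
Context {C : numFieldType} (c h : C) (k : nat) {U : vectType C} (x : U -> U).
Context (Hx : linear x) {W : lmodType C} (L : int -> W -> W) (i : U -> W).
Hypothesis hW : induced_module c x L i.
Hypothesis hker : frakL0_kernel L i = [set 0].

(** On coordinates the canonical map [f] is the inclusion of S in U, hence injective, and its image
    is the submodule generated by [i] of S. The kernel defining L_0(S) is carried into that of [W],
    which is zero. *)
Lemma frakL0_of_subspace (S : {vspace U}) (X : set W) :
  (forall u, u \in S -> x u \in S) -> submodule L X ->
  (forall u, u \in S -> X (i u)) ->
  (forall Y, submodule L Y -> (forall u, u \in S -> Y (i u)) -> X `<=` Y) ->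
  is_frakL0_of_subspace c x L i S X.
Proof.
move=> xS HX XS Xmin; split=> //.
pose x' := fun s : subvs_of S => vsproj S (x (vsval s)).
have Hx' : linear x' by move=> a u v; rewrite /x' linearP Hx linearP.
have hM := induced_part_module c Hx'.
case: (hW) => HL [lini ipos i0] _.
have Hg : degree_zero_map x' L (fun s => i (vsval s)).
  split=> [a u v|n u n0|u]; first by rewrite linearP lini.
    exact: ipos.
  by rewrite i0 /x' vsprojK // xS // subvsP.
have [f [[Hf fL fi] _]] : exists! f, [/\ linear f,
   forall n w, f (Lpart c x' n w) = L n (f w) & forall u, f (mono [::] u) = i (vsval u)].
  by case: hM => _ _; apply.
have f_inj w : f w = 0 -> w = 0.
  have coord_f t v : is_part t ->
      pbw_coord Hx hW t (f v) = vsval (pbw_coord Hx' hM t v).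
    move=> Ht; move: v; apply: (induced_eq Hx' hM).
    - exact: linear_comp (linear_coord Hx hW t) Hf.
    - by move=> a u v; rewrite (linear_coord Hx' hM t) linearP.
    move=> s u Hs; rewrite (word_hom _ _ fL) fi !coord_word //.
    by case: eqP => // _; rewrite linear0.
  move=> fw0; apply: (coord_inj (Hx := Hx') (hW := hM)) => t Ht; apply/val_inj.
  by rewrite -[LHS]coord_f // fw0 (lin0 (linear_coord Hx hW t)) linear0.
exists (part_module (subvs_of S)), (Lpart c x'), (mono [::]), f; split=> //.
  apply/seteqP; split=> w; last first.
    move=> Hw; suff : frakL0_kernel L i (f w) by rewrite hker.
    (* Every operator [y] of the enveloping algebra on [W] lifts along [f] to some [y'], and [f]
       preserves degrees. *)
    move=> y Hy; have [y' [Hy' yf]] : exists y', generated_algebra (range (Lpart c x')) y' /\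
        forall v, y (f v) = f (y' v).
      elim: Hy => [g [n _ <-]||a g1 g2 _ [y1 [H1 E1]] _ [y2 [H2 E2]]
        |g1 g2 _ [y1 [H1 E1]] _ [y2 [H2 E2]]].
      - by exists (Lpart c x' n); split=> [|v]; [apply: GenAlgBase; exists n|rewrite fL].
      - by exists id; split=> //; apply: GenAlgOne.
      - exists (fun v => a *: y1 v + y2 v); split=> [|v]; first exact: GenAlgLin.
        by rewrite E1 E2 Hf.
      exists (y1 \o y2); split=> [|v /=]; first exact: GenAlgMul.
      by rewrite E2 E1.
    rewrite yf; move: (y' w) (Hw _ Hy').
    apply: (lspan_min (S := [set v | lspan _ (f v)])).
      by apply: subspace_preimage => //; apply: subspace_lspan.
    move=> v [l l0]; move: v.
    apply: (lspan_min (S := [set v | lspan _ (f v)])).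
      by apply: subspace_preimage => //; apply: subspace_lspan.
    move=> _ [s [u [Hs sl ->]]]; apply: sub_lspan; exists l => //; apply: sub_lspan.
    exists s, (vsval u); split=> //.
    by rewrite -/(word (Lpart c x') s _) (word_hom _ _ fL) fi.
  move=> fw0; rewrite (f_inj _ fw0) => y Hy.
  have Hylin : linear y.
    elim: Hy => [g [n _ <-]||a g1 g2 _ H1 _ H2|g1 g2 _ H1 _ H2].
    - exact: linear_Lpart.
    - exact: linear_id.
    - by apply: linear_add => //; apply: linear_scale.
    - exact: linear_comp.
  by rewrite (lin0 Hylin); apply: (subspace_lspan _).1.
have linf s := linear_word (linear_L hW) s.
apply/seteqP; split=> [_ [w _ <-]|].
  move: w; apply: (part_module_ind (S := [set w | X (f w)])).
    exact: subspace_preimage Hf HX.1.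
  move=> s u Hs /=; rewrite -(word_mono c Hx') // (word_hom _ _ fL) fi.
  by apply: word_submodule => //; apply: XS; apply: subvsP.
apply: Xmin; last first.
  by move=> u uS; exists (mono [::] (vsproj S u)) => //; rewrite fi vsprojK.
split; last by move=> n _ [w _ <-]; exists (Lpart c x' n w); rewrite ?fL.
split; first by exists 0; rewrite ?(lin0 Hf).
by move=> a _ _ [u _ <-] [v _ <-]; exists (a *: u + v); rewrite ?Hf.
Qed.
End FrakL0OfSubspace.

(** * Interlocking and pseudo-traces for the modules attached to C[x]/((x-h)^k) *)

Theorem corollary7p1 (R : realType) (c h : R[i]) (k : nat) (hk : (0 < k)%N)
  (V : voa R[i]) (hV : is_universal_virasoro_voa c V)
  (* the Verma module M(c,h), and T(c,h) = 0 *)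
  (M : lmodType R[i]) (LM : int -> M -> M) (v0 : M)
  (hM : verma_module c h LM v0)
  (T : set M) (hT : maximal_proper_submodule LM T) (hT0 : T = [set 0])
  (* the V-module W = M_0(U(c,h,k)) *)
  (W : vmodule V) (i : Uchk h k -> W)
  (hW : induced_module c (Ux h k) (vmodL W) i) :
  [/\ frakL0_kernel (vmodL W) i = [set 0],
      strongly_interlocked W /\ strongly_interlocked_length W k,
      pstr_well_defined W k /\
        forall v : V, exists! a : R[i] -> nat -> R[i], graded_pstr W k v a,
      forall u : nat -> Uchk h k, jordan_basis u ->
        let Wj j := submodule_generated (modes W)
                      (i @` [set x | x \in span_upto u j]) in
        [/\ forall j, (j <= k)%N ->
              is_frakL0_of_subspace c (Ux h k) (vmodL W) i
                (span_upto u j) (Wj j) /\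
              interlocked (Wj j) (Wj (k - j)%N),
            Wj 1%N = submodule_generated (modes W) [set i (u 1%N)],
            Wj 1%N = socle (modes W),
            Wj k.-1 = radical (modes W) &
            interlocked (socle (modes W)) (radical (modes W))] &
      forall (v : V) (l : nat),
        [/\ degree_space (vmodL W) i l = weight_space W (h + l%:R),
            has_dim (socle (modes W) `&` weight_space W (h + l%:R))
              (partitions l) &
            exists (b : nat -> 'I_(partitions l) -> W)
                   (X : nat -> nat -> 'M[R[i]]_(partitions l))
                   (A : 'M[R[i]]_(partitions l))
                   (D : nat -> 'M[R[i]]_(partitions l))
                   (B : 'M[R[i]]_(partitions l)),
              [/\ block_basis k (weight_space W (h + l%:R)) b,
                  is_basis (socle (modes W) `&` weight_space W (h + l%:R))
                    (b 0%N),
                  block_matrix_of k b (zero_mode v) X &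
                  block_form k X A D B]]].
Proof.
case: k hk i hW => // K _ i hW; rewrite hT0 in hT.
(* The chain of powers of x - h serves the claims in which no Jordan basis is given; below, the
   given basis supplies the chain instead. *)
have Hx := @linear_Ux _ h K; have He := @Uchk_chain _ h K.
have hker := frakL0_kernel_trivial hM hT Hx hW He.
split=> //.
- have SI := uniserial_strongly_interlocked hV hM hT Hx hW He.
  by split=> //; exists K.+1.
- split; first exact: (uniserial_pstr_well_defined hV hM hT Hx hW He).
  exact: (graded_pstr_unique hV hM hT Hx hW He).
- move=> u Hu Wj; have He' := jordan_basis_chain Hu.
  have HU := theta_uniserial hV hM hT Hx hW He'.
  (* All claims on the [Wj] reduce to kernels of powers of [theta]: [u 1], ..., [u j] are the first
     j vectors of the chain and generate the j-th kernel. *)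
  have WjE j : (j <= K.+1)%N -> Wj j = iter_ker (theta Hx hW He') j.
    move=> jk; apply/seteqP; split=> [w|w Hw S HS iS].
      apply; first exact: (submodule_iter_ker HU).
      move=> _ [s /span_uptoP[a ->] <-]; rewrite (lin_sum (linear_i hW)).
      apply: subspace_sum => [|b _]; first exact: (submodule_iter_ker HU jk).1.
      rewrite (linZ (linear_i hW)); apply: subspaceZ.
        exact: (submodule_iter_ker HU jk).1.
      by apply/(chain_sub_e Hx hW He'); rewrite ?(leq_trans (ltn_ord b)).
    apply: (chain_sub_gen jk _ _ Hw); first exact/(submodule_modes hV).
    move=> b bj; apply: iS; exists (u b.+1) => //=; apply/span_uptoP.
    by have [a Ea] := combination_basis (fun b' : 'I_j => u b'.+1) (Ordinal bj);
      exists (fun n => if insub n is Some n' then a n' else 0);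
      rewrite [LHS]Ea; apply: eq_bigr => n _; rewrite valK.
  split.
  + move=> j jk; split; last first.
      rewrite !WjE ?leq_subr //; exact: (uniserial_interlocked hV hM hT Hx hW He').
    apply: (frakL0_of_subspace Hx hW hker).
    * move=> s /span_uptoP[a ->]; rewrite (lin_sum Hx).
      apply: rpred_sum => -[b bj] _ /=; rewrite (linZ Hx); apply: rpredZ.
      have u_in n : (n < j)%N -> u n.+1 \in span_upto u j.
        by move=> nj; apply/memv_span/map_f; rewrite mem_iota add1n.
      case: Hu => _ u1 uS; case: b bj => [|b] bj; first by rewrite u1 rpredZ ?u_in.
      by rewrite uS ?rpredD ?rpredZ ?u_in ?(leq_trans bj) ?(ltnW bj).
    * by rewrite WjE //; apply/(submodule_modes hV); apply: (submodule_iter_ker HU).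
    * by move=> s sS Y HY; apply; exists s.
    move=> Y HY iY w; apply; first exact/(submodule_modes hV).
    by move=> _ [s sS <-]; apply: iY.
  + apply/seteqP; split=> w Hw S HS uS; apply: Hw => //; last first.
      by move=> _ ->; apply: uS; exists (u 1%N) => //=; apply/memv_span/mem_head.
    move=> _ [s /span_uptoP[a ->] <-]; rewrite big_ord1 (linZ (linear_i hW)).
    by apply: (subspaceZ _ HS.1); apply: uS.
  + by rewrite WjE // (uniserial_socle HU isT).
  + by rewrite WjE // (uniserial_radical HU isT).
  rewrite (uniserial_socle HU isT) (uniserial_radical HU isT).
  have := uniserial_interlocked hV hM hT Hx hW He' (isT : (1 <= K.+1)%N).
  by rewrite subn1.
move=> v l; have HU := theta_uniserial hV hM hT Hx hW He.
have [b [Hb H1]] := degree_blocks Hx hW He l; split.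
- exact: (weight_degree Hx hW He).
- by rewrite (uniserial_socle HU isT); exists (b 0%N).
have [X [A [D [B [HX HB]]]]] :=
  weight_preserving_block_form hV hM hT Hb (weight_preserving_zero_mode W v).
exists b, X, A, D, B; split=> //; first exact: Hb.1.
by rewrite (uniserial_socle HU isT).
Qed.
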